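(* Let $V\simeq\mathbb{C}^n$ and $1\le \ell\le n-1$. Let $(\alpha^1,\dots,\alpha^s)$ be a Schubert problem for $\mathrm{Gr}(\ell,V)$, and suppose that $F^1_\bullet,\dots,F^s_\bullet$ are general (complete) flags given by invertible $n\times n$ matrices $\Phi^1,\dots,\Phi^s$, i.e. $F^i_\bullet=R_\bullet(\Phi^i)$. Then the system of equations $$(M\Phi^s)(\Phi^i)^{-1}N_i\;=\;0_{\ell\times(n-\ell)}\qquad\text{for } i=1,\dots,s-1,$$ where $(M,N_1,\dots,N_{s-1})\in\mathcal{M}_{\alpha^s}\times\mathcal{N}_{\alpha^1}\times\dots\times\mathcal{N}_{\alpha^{s-1}}$, defines the instance $$X_{\alpha^1}F^1_\bullet\cap X_{\alpha^2}F^2_\bullet\cap\dots\cap X_{\alpha^s}F^s_\bullet$$ of the Schubert problem (via $(M,N_1,\dots,N_{s-1})\mapsto R_\ell(M\Phi^s)$, which identifies the set of common zeroes bijectively with the points of the intersection) as the common zeroes of $(s-1)\cdot\ell(n-\ell)$ bilinear equations in $$\sum_{i=1}^s\bigl(\ell(n-\ell)-|\alpha^i|\bigr)\;=\;(s-1)\cdot\ell(n-\ell)$$ variables, exhibiting the Schubert problem as a square system of equations (as many equations as variables).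
   Context: Notation. $[n]=\{1,\dots,n\}$. Fix a basis $e_1,\dots,e_n$ of the complex vector space $V$ corresponding to columns of matrices, with dual basis $e_1^*,\dots,e_n^*$ of $V^*$. $\mathrm{Gr}(\ell,V)$ is the Grassmannian of $\ell$-dimensional linear subspaces of $V$. For a full rank matrix $M$ with $n$ columns, $R_\ell(M)$ is the span of its first $\ell$ rows; for an invertible $n\times n$ matrix $\Phi$, $R_\bullet(\Phi)$ is the complete flag $R_1(\Phi)\subsetneq R_2(\Phi)\subsetneq\dots\subsetneq R_n(\Phi)=V$. Schubert varieties. $\binom{[n]}{\ell}$ is the set of increasing sequences $\alpha=(\alpha_1<\dots<\alpha_\ell)$ in $[n]$. For a complete flag $F_\bullet$, $X_\alpha F_\bullet=\{H\in \mathrm{Gr}(\ell,V):\dim(H\cap F_{\alpha_i})\ge i,\ i=1,\dots,\ell\}$, of codimension $|\alpha|=\ell(n-\ell)-\sum_i(\alpha_i-i)$. A Schubert problem is a list $(\alpha^1,\dots,\alpha^s)$ of elements of $\binom{[n]}{\ell}$ with $|\alpha^1|+\dots+|\alpha^s|=\ell(n-\ell)$. ''General flags'' means that $(F^1_\bullet,\dots,F^s_\bullet)$ lies in a suitable dense Zariski open subset of the product of $s$ copies of the variety of complete flags. Local coordinates. For $\alpha\in\binom{[n]}{\ell}$, $\mathcal{M}_\alpha$ is the set of $\ell\times n$ echelon matrices $(m_{i,j})$ with pivots $\alpha$: $m_{i,\alpha_i}=1$, $m_{i,j}=0$ for $j>\alpha_i$, $m_{k,\alpha_i}=0$ for $k\neq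 i$, all other entries free. For $\gamma\in\binom{[n]}{m}$, $\mathcal{M}^\gamma$ is the set of $m\times n$ matrices in which, with $c_j=n+1-\gamma_{m+1-j}$, the first nonzero entry of row $j$ is a $1$ in column $c_j$, this entry is the only nonzero entry of its column, and the remaining entries to its right in row $j$ are free. For $\alpha\in\binom{[n]}{\ell}$, $\alpha^\perp\in\binom{[n]}{n-\ell}$ is defined by: $j\in\alpha^\perp$ iff $n+1-j\notin\alpha$. Finally $\mathcal{N}_\alpha=\{M^T: M\in\mathcal{M}^{\alpha^\perp}\}$, a set of $n\times(n-\ell)$ matrices. $\mathcal{M}_\alpha$ and $\mathcal{N}_\alpha$ are affine spaces of dimension $\ell(n-\ell)-|\alpha|$; their free entries are the variables. *)

(* Defs.v *)
From mathcomp Require Export all_boot all_order all_algebra.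
From mathcomp Require Export complex mpoly.
From mathcomp Require Export boolp classical_sets functions reals.

Set Implicit Arguments.
Unset Strict Implicit.
Unset Printing Implicit Defensive.

Import GRing.Theory Num.Theory.

(* Increasing sequences have 1-based entries, as in [n] = {1, ..., n}, while
   rows, columns and positions are 0-based: alpha_(i+1) is nth 0 alpha i, and
   j : 'I_n stands for column j.+1. *)

Definition incr_seq (n m : nat) (a : seq nat) : bool :=
  [&& size a == m, sorted ltn a & all (fun x => 1 <= x <= n) a].

(* For a in incr_seq n l no subtraction below truncates. *)
Definition codim (n l : nat) (a : seq nat) : nat :=
  l * (n - l) - \sum_(i < l) (nth 0 a i - i.+1).

Definition schubert_problem (n l s : nat) (alpha : 'I_s -> seq nat) : Prop :=
  (forall i, incr_seq n l (alpha i)) /\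
  \sum_(i < s) codim n l (alpha i) = l * (n - l).

Definition perp (n : nat) (a : seq nat) : seq nat :=
  [seq j <- iota 1 n | n.+1 - j \notin a].

(* c_(j+1) = n + 1 - gamma_(m+1-(j+1)) *)
Definition cpivot (n m : nat) (gamma : seq nat) (j : nat) : nat :=
  n.+1 - nth 0 gamma (m - j.+1).

(* The embedding of {1, ..., s-1} in {1, ..., s}, for s = r.+1. *)
Definition but_last (r : nat) (i : 'I_r) : 'I_r.+1 := widen_ord (leqnSn r) i.

Local Open Scope classical_set_scope.
Local Open Scope ring_scope.

Section Flags.
Variables (K : fieldType) (n : nat).

Definition rowspan (m k : nat) (M : 'M[K]_(m, n)) : {vspace 'rV[K]_n} :=
  (<<[seq row i M | i : 'I_m <- enum 'I_m & (i < k)%N]>>)%VS.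

(* A flag is indexed by 0, ..., n, with the redundant F_0 = 0. *)
Definition flag : Type := {ffun 'I_n.+1 -> {vspace 'rV[K]_n}}.

Definition complete_flag (F : flag) : Prop :=
  (forall k : 'I_n.+1, \dim (F k) = k) /\
  (forall j k : 'I_n.+1, (j <= k)%N -> (F j <= F k)%VS).

Definition flag_of_mx (Phi : 'M[K]_n) : flag := [ffun k : 'I_n.+1 => rowspan k Phi].

Definition schubert_variety (l : nat) (a : seq nat) (F : flag) :
    set {vspace 'rV[K]_n} :=
  [set H | \dim H = l /\
     forall i : 'I_l, (i.+1 <= \dim (H :&: F (inord (nth 0%N a i))))%N].

(* The variety of complete flags is the quotient of GL_n by the group of lower
   triangular matrices, under flag_of_mx; its s-fold product is likewise a
   quotient of GL_n^s.  A set of s-tuples of complete flags is Zariski open when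
   its preimage in GL_n^s is, that is, when the complement of the preimage is
   the zero locus of a set S of polynomials in the s * n * n matrix entries. *)
Definition mx_entries (s : nat) (Phi : 'I_s -> 'M[K]_n) :
    'I_#|{: 'I_s * 'I_n * 'I_n}| -> K :=
  fun k => Phi (enum_val k).1.1 (enum_val k).1.2 (enum_val k).2.

Definition flags_zariski_open (s : nat) (U : set ('I_s -> flag)) : Prop :=
  (forall F, U F -> forall i, complete_flag (F i)) /\
  exists S : set {mpoly K[#|{: 'I_s * 'I_n * 'I_n}|]},
    forall Phi : 'I_s -> 'M[K]_n, (forall i, Phi i \in unitmx) ->
      (U (fun i => flag_of_mx (Phi i)) <->
       exists2 p, S p & p.@[mx_entries Phi] != 0).

Definition flags_zariski_dense (s : nat) (U : set ('I_s -> flag)) : Prop :=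
  forall W, flags_zariski_open W -> W !=set0 -> (U `&` W) !=set0.

End Flags.

Section LocalCoordinates.
Variables (K : fieldType) (n : nat).

Definition Mlower (l : nat) (a : seq nat) : set 'M[K]_(l, n) :=
  [set M | forall (i : 'I_l) (j : 'I_n),
     [/\ j.+1 = nth 0%N a i -> M i j = 1,
         (nth 0%N a i < j.+1)%N -> M i j = 0 &
         forall k : 'I_l, k != i -> j.+1 = nth 0%N a i -> M k j = 0]].

Definition Mupper (m : nat) (gamma : seq nat) : set 'M[K]_(m, n) :=
  [set M | forall (i : 'I_m) (j : 'I_n),
     [/\ j.+1 = cpivot n m gamma i -> M i j = 1,
         (j.+1 < cpivot n m gamma i)%N -> M i j = 0 &
         forall k : 'I_m, k != i -> j.+1 = cpivot n m gamma i -> M k j = 0]].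

Definition Ncoord (l : nat) (a : seq nat) : set 'M[K]_(n, n - l) :=
  trmx @` Mupper (perp n a).

End LocalCoordinates.

Arguments Ncoord {K n} l a.

(* Positions of the free entries of Mlower, Mupper and Ncoord. *)

Definition Mlower_free (n l : nat) (a : seq nat) (p : 'I_l * 'I_n) : bool :=
  (p.2.+1 < nth 0 a p.1)%N && [forall k : 'I_l, p.2.+1 != nth 0%N a k].

Definition Mupper_free (n m : nat) (gamma : seq nat) (p : 'I_m * 'I_n) : bool :=
  (cpivot n m gamma p.1 < p.2.+1)%N &&
  [forall k : 'I_m, p.2.+1 != cpivot n m gamma k].

Definition Ncoord_free (n l : nat) (a : seq nat) (p : 'I_n * 'I_(n - l)) : bool :=
  Mupper_free (perp n a) (p.2, p.1).

Section System.
Variables (n l r : nat) (alpha : 'I_r.+1 -> seq nat).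

Definition free_entry (v : ('I_l * 'I_n) + ('I_r * ('I_n * 'I_(n - l)))) : bool :=
  match v with
  | inl p => Mlower_free (alpha ord_max) p
  | inr q => Ncoord_free (alpha (but_last q.1)) q.2
  end.

Definition var : finType :=
  {v : ('I_l * 'I_n) + ('I_r * ('I_n * 'I_(n - l))) | free_entry v}.

Definition nvars : nat := #|var|.

Definition M_var (k : 'I_nvars) : bool :=
  match val (enum_val k) with inl _ => true | inr _ => false end.

Definition N_var (i : 'I_r) (k : 'I_nvars) : bool :=
  match val (enum_val k) with inl _ => false | inr q => q.1 == i end.

Definition eqn : finType := ('I_r * ('I_l * 'I_(n - l)))%type.

Variable K : fieldType.

Definition point : Type := ('M[K]_(l, n) * {ffun 'I_r -> 'M[K]_(n, n - l)})%type.

Definition local_coordinates : set point :=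
  [set z : point | Mlower (alpha ord_max) z.1 /\
     forall i : 'I_r, Ncoord l (alpha (but_last i)) (z.2 i)].

Definition free_values (z : point) : 'rV[K]_nvars :=
  \row_k match val (enum_val k) with
         | inl p => z.1 p.1 p.2
         | inr q => z.2 q.1 q.2.1 q.2.2
         end.

Definition system_lhs (Phi : 'I_r.+1 -> 'M[K]_n) (z : point) (i : 'I_r) :
    'M[K]_(l, n - l) :=
  (z.1 *m Phi ord_max) *m invmx (Phi (but_last i)) *m z.2 i.

Definition system_zeros (Phi : 'I_r.+1 -> 'M[K]_n) : set point :=
  [set z : point | local_coordinates z /\ forall i : 'I_r, system_lhs Phi z i = 0].

(* Degree at most one, rather than exactly one, in each of the two groups of
   variables, because the matrices have some entries fixed to 0 and 1. *)
Definition bilinear_poly (N : nat) (A B : pred 'I_N) (p : {mpoly K[N]}) : Prop :=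
  forall m, m \in msupp p ->
    [/\ (\sum_(k | A k) m k <= 1)%N, (\sum_(k | B k) m k <= 1)%N &
        forall k, ~~ A k -> ~~ B k -> m k = 0%N].

End System.

Arguments nvars n l {r} alpha.
Arguments M_var {n l r} alpha k.
Arguments N_var {n l r} alpha i k.
Arguments local_coordinates {n l r} alpha {K}.
Arguments free_values {n l r} alpha {K} z.
Arguments system_lhs {n l r K} Phi z i.
Arguments system_zeros {n l r} alpha {K} Phi.

(* Main.v *)
(* Let [a] be a set of columns and [c] the complementary one.  The echelon
   matrices with pivots [a] are [S_a + Q S_c] and the matrices of [Ncoord] are
   [S_c^T - S_a^T Q], with [S] the selection matrices and [Q i j = 0] unless
   [c j < a i].  The product of the two vanishes when the matrices [Q] agree.
   Since both have full rank, [A N = 0] with [A] of rank [l] and [N] in [Ncoord]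
   then says exactly that the row space of [A] lies in the open Schubert cell,
   with [N] determined by this row space.  So the zeroes of the system are the
   points of the intersection of the open cells, and it remains to show that for
   general flags the intersection of the Schubert varieties has no other point.
   Such a point lies in cells of dimensions d_1, ..., d_s with sum smaller than
   (s - 1) l (n - l).  The s-tuples of matrices whose flags have a common point
   in these cells are the image of a polynomial map in fewer than s n^2
   variables, hence satisfy a nontrivial polynomial relation. *)

Require Import Defs.
From mathcomp Require Import perm zify.

Set Implicit Arguments.
Unset Strict Implicit.
Unset Printing Implicit Defensive.

Import GRing.Theory Num.Theory.

Local Open Scope ring_scope.

(** * Polynomials *)

(** The integers [0, ..., size p - 1] are distinct in a numeric domain, and there are more of them
    than the degree of [p], so they cannot all be roots. *)
Lemma poly_nonroot (K : numDomainType) (p : {poly K}) :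
  p != 0 -> exists x, p.[x] != 0.
Proof.
move=> p_neq0; pose rs := [seq i%:R : K | i <- iota 0 (size p)].
have uniq_rs : uniq rs.
  by rewrite map_inj_uniq ?iota_uniq // => i j /eqP; rewrite eqr_nat => /eqP.
case: (boolP (all (root p) rs)) => [root_rs | /allPn[x _ px]]; last by exists x.
by have := max_poly_roots p_neq0 root_rs uniq_rs; rewrite size_map size_iota ltnn.
Qed.

(** Induction on the number of variables: [muni p] is [p] seen as a polynomial in the last variable.
    A point [v] keeps one of its coefficients nonzero, and [poly_nonroot] then supplies the last
    coordinate. *)
Lemma mpoly_nonroot (K : numDomainType) (n : nat) (p : {mpoly K[n]}) :
  p != 0 -> exists v : 'I_n -> K, p.@[v] != 0.
Proof.
elim: n p => [|n IHn] p p_neq0.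
  exists (fun=> 0); apply: contraNneq p_neq0 => p0; apply/eqP/mpolyP => m.
  rewrite mcoeff0 -p0 mevalE.
  have m0 m' : m' = m by apply/mnmP => -[].
  case: (boolP (m \in msupp p)) => [m_in|m_out].
    rewrite (perm_big [:: m]) ?big_seq1 ?big_ord0 ?mulr1 //.
    apply: uniq_perm; rewrite ?msupp_uniq // => m'.
    by rewrite (m0 m') m_in inE eqxx.
  by rewrite (memN_msupp_eq0 m_out) big1_seq // => m' /andP[_]; rewrite (m0 m') (negPf m_out).
have /hasP[m0 m0p _] : has predT (msupp p).
  by rewrite has_predT lt0n size_eq0 msupp_eq0.
pose low (m : 'X_{1..n.+1}) := [multinom m (widen_ord (leqnSn n) i) | i < n].
have lowK m m' : low m = low m' -> m ord_max = m' ord_max -> m = m'.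
  move=> lo la; apply/mnmP => i; case: (unliftP ord_max i) => [j ->|->] //.
  have := congr1 (fun t : 'X_{1..n} => t j) lo; rewrite !mnmE.
  by suff -> : widen_ord (leqnSn n) j = lift ord_max j
    by []; apply: val_inj; rewrite /= /bump leqNgt ltn_ord.
(* By [lowK], only [m0] contributes to the coefficient of [low m0] here, so this coefficient of
   [muni p] is nonzero. *)
have [v cv] : exists v, ((muni p)`_(m0 ord_max)).@[v] != 0.
  apply: IHn; apply/eqP => /(congr1 (mcoeff (low m0))).
  rewrite mcoeff0 muniE coef_sum raddf_sum /= (bigD1_seq m0) //=.
  rewrite coefZ coefXn eqxx mulr1 mcoeffZ mcoeffX eqxx mulr1 big1 ?addr0.
    by apply/eqP; rewrite -mcoeff_msupp.
  move=> m m_neq; rewrite coefZ coefXn.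
  case: eqP => [e|_]; last by rewrite mulr0 mcoeff0.
  rewrite mulr1 mcoeffZ mcoeffX; case: eqP => [e'|_]; last by rewrite mulr0.
  by rewrite (lowK _ _ e' (esym e)) eqxx in m_neq.
have [x rx] : exists x, (map_poly (meval v) (muni p)).[x] != 0.
  apply: poly_nonroot; apply: contraNneq cv => r0.
  by rewrite -(coef_map (meval v)) r0 coef0.
exists (fun i => if unlift ord_max i is Some j then v j else x).
move: rx; congr (_ != 0); rewrite muniE [RHS]mevalE rmorph_sum horner_sum; apply: eq_bigr => m _.
rewrite -mul_polyC rmorphM /= map_polyC /= map_polyXn hornerM hornerC hornerXn.
rewrite mevalZ mevalX -mulrA; congr (_ * _); rewrite [RHS]big_ord_recr /= unlift_none.
congr (_ * _); apply: eq_bigr => i _; rewrite mnmE.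
suff -> : widen_ord (leqnSn n) i = lift ord_max i by rewrite liftK.
by apply: val_inj; rewrite /= /bump leqNgt ltn_ord.
Qed.

Lemma mdeg_msuppM (R : nzRingType) (n k1 k2 : nat) (p q : {mpoly R[n]}) :
  (forall x, x \in msupp p -> (mdeg x <= k1)%N) ->
  (forall x, x \in msupp q -> (mdeg x <= k2)%N) ->
  forall x, x \in msupp (p * q) -> (mdeg x <= k1 + k2)%N.
Proof.
move=> pk qk x /msuppM_le /allpairsP[[y z] /= [yp zq ->]].
by rewrite mdegD leq_add ?pk ?qk.
Qed.

Lemma alg_dependence (K : fieldType) (m N : nat) (f : 'I_N -> {mpoly K[m]}) :
  (m < N)%N ->
  exists2 P : {mpoly K[N]}, P != 0 & P \mPo [tuple f i | i < N] = 0.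
Proof.
move=> m_lt_N.
(* There are [d ^ N] monomials with exponents below [d]; substituting [f] in
   them gives polynomials with exponents below [(N * D).+1 * d], whose space has
   smaller dimension once [d] is large. *)
pose D := (\max_(i < N) (msize (f i)))%N.
pose d := ((N * D).+1 ^ m).+1.
pose mon (t : {ffun 'I_N -> 'I_d}) : 'X_{1..N} := [multinom (t i : nat) | i < N].
have mon_inj : injective mon.
  move=> t t' e; apply/ffunP => i; apply: val_inj.
  by have := congr1 (fun t : 'X_{1..N} => t i) e; rewrite !mnmE.
pose g t := 'X_[mon t] \mPo [tuple f i | i < N].
pose box := {ffun 'I_m -> 'I_((N * D).+1 * d)}.
pose mon' (t : box) : 'X_{1..m} := [multinom (t i : nat) | i < m].
have mdeg_g t x : x \in msupp (g t) -> (mdeg x < (N * D).+1 * d)%N.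
  move=> xt; suff : (mdeg x <= N * d.-1 * D)%N.
    move/leq_ltn_trans; apply; rewrite mulnAC mulSn.
    apply: (@leq_ltn_trans (N * D * d)); first by rewrite leq_mul2l leq_pred orbT.
    by rewrite -[ltnLHS]add0n ltn_add2r.
  move: x xt; rewrite /g comp_mpolyX.
  have -> : (N * d.-1 * D = \sum_(i < N) d.-1 * D)%N.
    by rewrite sum_nat_const card_ord mulnA.
  apply: (big_ind2 (fun p k => forall x, x \in msupp p -> (mdeg x <= k)%N)) => //.
  - by move=> x; rewrite msupp1 inE => /eqP->; rewrite mdeg0.
  - by move=> p k q k' pk qk; apply: mdeg_msuppM.
  move=> i _; rewrite tnth_mktuple mnmE.
  have : (t i <= d.-1)%N by rewrite -ltnS ltn_ord.
  move: (nat_of_ord (t i)) d.-1 => j e; elim: j e => [|j IHj] e lt_je x.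
    by rewrite expr0 msupp1 inE => /eqP->; rewrite mdeg0.
  case: e lt_je => // e; rewrite ltnS exprS mulSn => le_je.
  apply: mdeg_msuppM => [y /msize_mdeg_lt /ltnW le_y|]; last exact: IHj.
  exact: leq_trans le_y (leq_bigmax i).
pose A := \matrix_(i < #|{ffun 'I_N -> 'I_d}|, j < #|box|)
            (g (enum_val i))@_(mon' (enum_val j)).
(* The choice of [d] gives [((N * D).+1 * d) ^ m < d ^ m.+1 <= d ^ N]. *)
have lt_card : (#|box| < #|{ffun 'I_N -> 'I_d}|)%N.
  rewrite !card_ffun !card_ord expnMn.
  apply: leq_trans (_ : d ^ m.+1 <= _)%N; last by rewrite leq_pexp2l.
  by rewrite expnS ltn_mul2r expn_gt0 ltnS leqnn.
(* A vector of the left kernel is a linear relation between the [g t]; its entries are the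
   coefficients of [P]. *)
have /rowV0Pn [v /sub_kermxP vA v_neq0] : kermx A != 0.
  rewrite kermx_eq0 -row_leq_rank -ltnNge.
  exact: leq_ltn_trans (rank_leq_col A) _.
exists (\sum_i v 0 i *: 'X_[mon (enum_val i)]).
  apply: contraNneq v_neq0 => P0; apply/eqP/rowP => i; rewrite mxE.
  have := congr1 (mcoeff (mon (enum_val i))) P0; rewrite mcoeff0 raddf_sum /=.
  rewrite (bigD1 i) //= mcoeffZ mcoeffX eqxx mulr1 big1 ?addr0 // => j ji.
  rewrite mcoeffZ mcoeffX (inj_eq mon_inj) (inj_eq enum_val_inj) (negPf ji).
  by rewrite mulr0.
apply/mpolyP => x; rewrite mcoeff0 (raddf_sum (comp_mpoly _)) raddf_sum /=.
(* Coefficients of high degree vanish by [mdeg_g]; all other monomials are indexed by [box], where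
   the relation [vA] applies. *)
case: (leqP ((N * D).+1 * d) (mdeg x)) => [le_x|lt_x].
  rewrite big1 // => i _; rewrite comp_mpolyZ mcoeffZ memN_msupp_eq0 ?mulr0 //.
  by apply/negP => /mdeg_g; rewrite ltnNge le_x.
have lt_xi i : (x i < (N * D).+1 * d)%N.
  by apply: leq_ltn_trans lt_x; rewrite mdegE (bigD1 i) //= leq_addr.
have := congr1 (fun w : 'rV_#|box| => w 0 (enum_rank [ffun i => Ordinal (lt_xi i)])) vA.
rewrite !mxE; apply: etrans; apply: eq_bigr => i _.
rewrite mxE comp_mpolyZ mcoeffZ enum_rankK; congr (_ * (g _)@__).
by apply/mnmP => k; rewrite mnmE ffunE.
Qed.

(** * Polynomial maps *)

Section PolynomialMaps.
Variable K : fieldType.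

(** Indexing the variables by any finite type allows a parameter space to be written as a sum of
    types, one for each group of parameters. *)
Definition polyfun (T : finType) (g : (T -> K) -> K) : Prop :=
  exists p : {mpoly K[#|T|]}, forall x, g x = p.@[fun k => x (enum_val k)].

Lemma polyfunC (T : finType) (k : K) : @polyfun T (fun=> k).
Proof. by exists k%:MP => x; rewrite mevalC. Qed.

Lemma polyfunX (T : finType) (t : T) : polyfun (fun x => x t).
Proof. by exists 'X_(enum_rank t) => x; rewrite mevalXU enum_rankK. Qed.

Lemma polyfunD (T : finType) (f g : (T -> K) -> K) :
  polyfun f -> polyfun g -> polyfun (fun x => f x + g x).
Proof. by move=> [p fp] [q gq]; exists (p + q) => x; rewrite mevalD fp gq. Qed.

Lemma polyfunN (T : finType) (f : (T -> K) -> K) :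
  polyfun f -> polyfun (fun x => - f x).
Proof. by move=> [p fp]; exists (- p) => x; rewrite mevalN fp. Qed.

Lemma polyfunM (T : finType) (f g : (T -> K) -> K) :
  polyfun f -> polyfun g -> polyfun (fun x => f x * g x).
Proof. by move=> [p fp] [q gq]; exists (p * q) => x; rewrite mevalM fp gq. Qed.

Lemma polyfun_sum (T I : finType) (f : I -> (T -> K) -> K) :
  (forall i, polyfun (f i)) -> polyfun (fun x => \sum_i f i x).
Proof.
move=> /fin_all_exists[p fp]; exists (\sum_i p i) => x.
by rewrite raddf_sum; apply: eq_bigr => i _.
Qed.

Definition polymx (T : finType) (m n : nat) (A : (T -> K) -> 'M[K]_(m, n)) : Prop :=
  forall i j, polyfun (fun x => A x i j).

Lemma polymxC (T : finType) (m n : nat) (A : 'M[K]_(m, n)) : @polymx T m n (fun=> A).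
Proof. by move=> i j; apply: polyfunC. Qed.

Lemma polymxD (T : finType) (m n : nat) (A B : (T -> K) -> 'M[K]_(m, n)) :
  polymx A -> polymx B -> polymx (fun x => A x + B x).
Proof.
move=> Ap Bp i j; have [p pE] := polyfunD (Ap i j) (Bp i j).
by exists p => x; rewrite mxE pE.
Qed.

Lemma polymxN (T : finType) (m n : nat) (A : (T -> K) -> 'M[K]_(m, n)) :
  polymx A -> polymx (fun x => - A x).
Proof.
by move=> Ap i j; have [p pE] := polyfunN (Ap i j); exists p => x; rewrite mxE pE.
Qed.

Lemma polymxM (T : finType) (m n p : nat)
    (A : (T -> K) -> 'M[K]_(m, n)) (B : (T -> K) -> 'M[K]_(n, p)) :
  polymx A -> polymx B -> polymx (fun x => A x *m B x).
Proof.
move=> Ap Bp i j.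
have [q qE] := polyfun_sum (fun k => polyfunM (Ap i k) (Bp k j)).
by exists q => x; rewrite mxE qE.
Qed.

(** Evaluating the relation of [alg_dependence] at [x] shows that [P] vanishes on the image of the
    map. *)
Lemma polyfun_image (T : finType) (N : nat) (f : 'I_N -> (T -> K) -> K) :
  (forall k, polyfun (f k)) -> (#|T| < N)%N ->
  exists2 P : {mpoly K[N]}, P != 0 & forall x, P.@[fun k => f k x] = 0.
Proof.
move=> /fin_all_exists[p fp] /(alg_dependence p)[P P0 Pp]; exists P => // x.
have := congr1 (meval (fun k => x (enum_val k))) Pp; rewrite meval0 comp_mpoly_meval.
by move=> <-; apply: meval_eq => k; rewrite tnth_mktuple.
Qed.

End PolynomialMaps.

(** * Complementary sets of columns *)

Section Pivots.
Variables (n l m : nat).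

Definition complementary (a : 'I_l -> 'I_n) (c : 'I_m -> 'I_n) : Prop :=
  [/\ injective a, injective c, forall i j, a i != c j &
      forall x, (exists i, x = a i) \/ (exists j, x = c j)].

Lemma card_imsetU (a : 'I_l -> 'I_n) (c : 'I_m -> 'I_n) (A : {set 'I_l}) (C : {set 'I_m}) :
  injective a -> injective c -> (forall i j, a i != c j) ->
  #|a @: A :|: c @: C| = (#|A| + #|C|)%N.
Proof.
move=> a_inj c_inj ac; rewrite cardsU disjoint_setI0 ?cards0 ?subn0 ?card_imset //.
apply/pred0P => y /=; apply/negP => /andP[/imsetP[i _ ->] /imsetP[j _ /eqP]].
by apply/negP.
Qed.

(** The two disjoint images have [l + m >= n] elements together, which leaves no room for a column
    [x] outside both. *)
Lemma complementary_card (a : 'I_l -> 'I_n) (c : 'I_m -> 'I_n) :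
  injective a -> injective c -> (forall i j, a i != c j) -> (n <= l + m)%N ->
  complementary a c.
Proof.
move=> a_inj c_inj ac n_le; split=> // x; apply: contrapT => /not_orP[xa xc].
have : (#|a @: [set: _] :|: c @: [set: _]| <= #|[set~ x]|)%N.
  apply/subset_leq_card/fintype.subsetP => y; rewrite !inE => /orP[]/imsetP[i _ ->].
    by apply/eqP => e; apply: xa; exists i.
  by apply/eqP => e; apply: xc; exists i.
rewrite cardsC1 card_imsetU // !cardsT !card_ord => le_n.
by case: n x le_n n_le {xa xc} => [[]|k] //= _ /leq_ltn_trans h /h; rewrite ltnn.
Qed.

Variables (K : fieldType) (a : 'I_l -> 'I_n) (c : 'I_m -> 'I_n).

(** Multiplying by it on the left selects the rows [f i]; multiplying by its transpose on the right
    selects the columns [f i]. *)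
Definition selmx k (f : 'I_k -> 'I_n) : 'M[K]_(k, n) := \matrix_(i, j) (f i == j)%:R.

Lemma mul_selmx k p (f : 'I_k -> 'I_n) (X : 'M[K]_(n, p)) i j :
  (selmx f *m X) i j = X (f i) j.
Proof.
rewrite mxE (bigD1 (f i)) //= mxE eqxx mul1r big1 ?addr0 // => x xi.
by rewrite mxE eq_sym (negPf xi) mul0r.
Qed.

Lemma mul_selmxT k p (f : 'I_k -> 'I_n) (X : 'M[K]_(p, n)) i j :
  (X *m (selmx f)^T) i j = X i (f j).
Proof. by rewrite -[X]trmxK -trmx_mul [LHS]mxE mul_selmx !mxE. Qed.

Lemma selmxK k (f : 'I_k -> 'I_n) : injective f -> selmx f *m (selmx f)^T = 1%:M.
Proof. by move=> f_inj; apply/matrixP => i j; rewrite mul_selmxT !mxE inj_eq. Qed.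

Hypothesis acP : complementary a c.

Lemma selmx_aa : selmx a *m (selmx a)^T = 1%:M.
Proof. by apply: selmxK; case: acP. Qed.

Lemma selmx_cc : selmx c *m (selmx c)^T = 1%:M.
Proof. by apply: selmxK; case: acP. Qed.

Lemma selmx_ac : selmx a *m (selmx c)^T = 0.
Proof.
by apply/matrixP => i j; rewrite mul_selmxT !mxE; case: acP => _ _ /(_ i j)/negPf->.
Qed.

Lemma selmx_ca : selmx c *m (selmx a)^T = 0.
Proof. by apply: trmx_inj; rewrite trmx_mul trmxK selmx_ac trmx0. Qed.

Lemma selmx_sum : (selmx a)^T *m selmx a + (selmx c)^T *m selmx c = 1%:M.
Proof.
case: acP => a_inj c_inj ac cov; apply/matrixP => x y.
have [[i ->]|[j ->]] := cov x; rewrite !mxE.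
  rewrite (bigD1 i) //= !mxE eqxx mul1r big1 => [|k ki]; last first.
    by rewrite !mxE (inj_eq a_inj) (negPf ki) mul0r.
  by rewrite big1 ?addr0 // => j _; rewrite !mxE eq_sym (negPf (ac i j)) mul0r.
rewrite big1 => [|i _]; last by rewrite !mxE (negPf (ac i j)) mul0r.
rewrite (bigD1 j) //= !mxE eqxx mul1r big1 ?addr0 ?add0r // => k kj.
by rewrite !mxE (inj_eq c_inj) (negPf kj) mul0r.
Qed.

Lemma selmx_decomp p (X : 'M[K]_(p, n)) :
  X = X *m (selmx a)^T *m selmx a + X *m (selmx c)^T *m selmx c.
Proof. by rewrite -!mulmxA -mulmxDr selmx_sum mulmx1. Qed.

(* The free entries of [echelon Q] and, up to sign, of [coechelon Q] are those
   of [Q]; the product of the two matrices vanishes. *)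
Definition tri (Q : 'M[K]_(l, m)) : Prop := forall i j, ~~ (c j < a i)%N -> Q i j = 0.
Definition echelon (Q : 'M[K]_(l, m)) : 'M[K]_(l, n) := selmx a + Q *m selmx c.
Definition coechelon (Q : 'M[K]_(l, m)) : 'M[K]_(n, m) :=
  (selmx c)^T - (selmx a)^T *m Q.

Lemma echelon_a Q : echelon Q *m (selmx a)^T = 1%:M.
Proof. by rewrite mulmxDl -mulmxA selmx_ca mulmx0 addr0 selmx_aa. Qed.

Lemma echelon_c Q : echelon Q *m (selmx c)^T = Q.
Proof. by rewrite mulmxDl -mulmxA selmx_cc mulmx1 selmx_ac add0r. Qed.

Lemma echelon_pivot Q i k : echelon Q i (a k) = (i == k)%:R.
Proof. by rewrite -mul_selmxT echelon_a mxE. Qed.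

Lemma echelon_free Q i j : echelon Q i (c j) = Q i j.
Proof. by rewrite -mul_selmxT echelon_c. Qed.

Lemma echelon_inj : injective echelon.
Proof. by move=> Q Q' QQ; rewrite -(echelon_c Q) QQ echelon_c. Qed.

(** Uniqueness of the reduced echelon form: the columns [a] of both sides are [1] and [B]. *)
Lemma echelon_eq B Q Q' : echelon Q = B *m echelon Q' -> B = 1%:M /\ Q = Q'.
Proof.
move=> e; have B1 : B = 1%:M.
  by rewrite -(echelon_a Q) e -mulmxA echelon_a mulmx1.
by split=> //; apply: echelon_inj; rewrite e B1 mul1mx.
Qed.

Lemma echelonP (M : 'M[K]_(l, n)) :
  (forall i k, M i (a k) = (i == k)%:R) -> M = echelon (M *m (selmx c)^T).
Proof.
move=> Ma; rewrite /echelon [LHS]selmx_decomp; congr (_ + _).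
suff -> : M *m (selmx a)^T = 1%:M by rewrite mul1mx.
by apply/matrixP => i k; rewrite mul_selmxT Ma mxE.
Qed.

(** The product vanishes when the columns [c] of [M] are its columns [a] times [Q]. Reassembling [M]
    from both blocks by [selmx_decomp] then factors it through [echelon Q]. *)
Lemma mul_coechelon p (M : 'M[K]_(p, n)) Q :
  M *m coechelon Q = 0 <-> M = M *m (selmx a)^T *m echelon Q.
Proof.
rewrite mulmxBr mulmxA; split=> [/eqP|->].
  rewrite subr_eq0 => /eqP e.
  by rewrite mulmxDr mulmxA -e -selmx_decomp.
rewrite -[_ *m echelon Q *m (selmx c)^T]mulmxA echelon_c.
by rewrite -[_ *m echelon Q *m (selmx a)^T]mulmxA echelon_a mulmx1 subrr.
Qed.

Lemma coechelon_a Q : selmx a *m coechelon Q = - Q.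
Proof. by rewrite mulmxBr selmx_ac mulmxA selmx_aa mul1mx sub0r. Qed.

Lemma coechelon_pivot Q j k : coechelon Q (c j) k = (j == k)%:R.
Proof.
by rewrite -mul_selmx mulmxBr selmx_cc mulmxA selmx_ca mul0mx subr0 mxE.
Qed.

Lemma coechelon_free Q i k : coechelon Q (a i) k = - Q i k.
Proof. by rewrite -mul_selmx coechelon_a mxE. Qed.

Lemma coechelonP (N : 'M[K]_(n, m)) :
  (forall j k, N (c j) k = (j == k)%:R) -> N = coechelon (- (selmx a *m N)).
Proof.
move=> Nc; rewrite /coechelon mulmxN opprK.
rewrite -[LHS]mul1mx -selmx_sum mulmxDl addrC -!mulmxA; congr (_ + _).
suff -> : selmx c *m N = 1%:M by rewrite mulmx1.
by apply/matrixP => j k; rewrite mul_selmx Nc mxE.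
Qed.

End Pivots.

Section Existence.
Variables (n l : nat).

Lemma complementary_exists (a : 'I_l -> 'I_n) :
  injective a -> exists c : {ffun 'I_(n - l) -> 'I_n}, complementary a c.
Proof.
move=> a_inj.
have card_c : #|~: (a @: [set: _])| = (n - l)%N.
  by rewrite cardsCs finset.setCK card_imset // cardsT !card_ord.
exists [ffun j => enum_val (cast_ord (esym card_c) j)].
apply: complementary_card => //.
- by move=> i j; rewrite !ffunE => /enum_val_inj /cast_ord_inj.
- move=> i j; rewrite ffunE; apply: contraTneq (enum_valP (cast_ord (esym card_c) j)).
  by move=> <-; rewrite inE negbK imset_f.
rewrite subnKC //; have := max_card (mem (a @: [set: _])).
by rewrite card_imset // cardsT !card_ord.
Qed.

Lemma card_ltn_ord (k p : nat) : (k <= p)%N -> #|[set x : 'I_p | x < k]%N| = k.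
Proof. by move=> k_le; rewrite -sum1dep_card (big_ord_narrow k_le) sum1_card card_ord. Qed.

(** This counts the parameters of a Schubert cell. Of the [a i] columns left of the pivot [a i],
    exactly [i] are pivots because [a] increases; the others are the [c j] with [c j < a i]. *)
Lemma card_tri (m : nat) (a : 'I_l -> 'I_n) (c : 'I_m -> 'I_n) :
  complementary a c -> {homo a : i j / (i < j)%N} ->
  #|[pred p : 'I_l * 'I_m | (c p.2 < a p.1)%N]| = (\sum_i (a i - i))%N.
Proof.
move=> [a_inj c_inj ac cov] a_incr.
have a_mono i j : (a i < a j)%N = (i < j)%N.
  case: (ltngtP i j) => [/a_incr|/a_incr|/val_inj ->]; rewrite ?ltnn //.
  by move=> /ltnW; rewrite leqNgt => /negPf.
rewrite -sum1_card -(pair_big_dep predT (fun i j => c j < a i)%N (fun _ _ => 1%N)) /=.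
apply: eq_bigr => i _; rewrite sum1_card.
have : [set x : 'I_n | x < a i]%N = a @: [set k : 'I_l | k < i]%N :|: c @: [set j | c j < a i]%N.
  apply/setP => x; rewrite !inE; apply/idP/orP => [lt_x|].
    have [[k e]|[j e]] := cov x; [left|right]; rewrite e imset_f // inE -?e //.
    by rewrite -a_mono -e.
  by case=> /imsetP[k]; rewrite inE => lt_k ->; rewrite ?a_mono.
move/(congr1 (fun A : {set 'I_n} => #|A|)).
rewrite card_ltn_ord ?[(a i <= n)%N]ltnW // card_imsetU //.
rewrite card_ltn_ord ?[(i <= l)%N]ltnW // => aE.
rewrite [in RHS]aE.
by rewrite addKn; apply: eq_card => j; rewrite inE.
Qed.

End Existence.

(** * Row spaces and echelon forms *)

Section RowSpan.
Variables (K : fieldType) (n : nat).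

Lemma rowspanP (m k : nat) (M : 'M[K]_(m, n)) (v : 'rV[K]_n) :
  v \in rowspan k M <->
  exists2 u : 'rV[K]_m, v = u *m M & forall j : 'I_m, (k <= j)%N -> u 0 j = 0.
Proof.
split=> [|[u -> u0]]; last first.
  rewrite mulmx_sum_row; apply: memv_suml => j _.
  case: (ltnP j k) => [lt_jk|/u0 ->]; last by rewrite scale0r mem0v.
  by apply/memvZ/memv_span/map_f; rewrite mem_filter lt_jk mem_enum.
rewrite /rowspan; set s := filter _ _.
have s_lt i : i \in s -> (i < k)%N by rewrite mem_filter => /andP[].
elim: s s_lt v => [_ v|i s IHs s_lt v].
  rewrite span_nil memv0 => /eqP->; exists 0; first by rewrite mul0mx.
  by move=> j _; rewrite mxE.
rewrite /= span_cons => /memv_addP[_ /vlineP[x ->] [w]].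
case/IHs => [j j_s|u -> u0 ->]; first by rewrite s_lt // inE j_s orbT.
exists (x *: delta_mx 0 i + u); first by rewrite mulmxDl -scalemxAl -rowE.
move=> j k_le; rewrite !mxE u0 // addr0 eqxx /=; case: eqP => [e|_]; last by rewrite mulr0.
by have := s_lt i (mem_head _ _); rewrite -e ltnNge k_le.
Qed.

Lemma rowspan_full (m : nat) (M : 'M[K]_(m, n)) (v : 'rV[K]_n) :
  v \in rowspan m M <-> exists u : 'rV[K]_m, v = u *m M.
Proof.
rewrite rowspanP; split=> [[u -> _]|[u ->]]; exists u => // j.
by rewrite leqNgt ltn_ord.
Qed.

Lemma rowspan_all (m : nat) (M : 'M[K]_(m, n)) :
  rowspan m M = <<[seq row i M | i <- enum 'I_m]>>%VS.
Proof.
by rewrite /rowspan; congr (span (map _ _)); apply/all_filterP/allP => i _; apply: ltn_ord.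
Qed.

Lemma rowspan_sub (m k : nat) (M : 'M[K]_(m, n)) (U : {vspace 'rV[K]_n}) :
  (forall i : 'I_m, (i < k)%N -> row i M \in U) -> (rowspan k M <= U)%VS.
Proof.
move=> MU; apply/subvP => v /rowspanP[u -> u0]; rewrite mulmx_sum_row.
apply: memv_suml => i _; case: (ltnP i k) => [/MU|/u0 ->]; first exact: memvZ.
by rewrite scale0r mem0v.
Qed.

Lemma rowspan_le (m k j : nat) (M : 'M[K]_(m, n)) :
  (k <= j)%N -> (rowspan k M <= rowspan j M)%VS.
Proof.
move=> le_kj; apply/subvP => v /rowspanP[u -> u0]; apply/rowspanP.
by exists u => // i le_ji; rewrite u0 // (leq_trans le_kj).
Qed.

Lemma eq_rowspan_mulr (m p k j : nat) (M : 'M[K]_(m, n)) (M' : 'M[K]_(p, n)) (A : 'M[K]_n) :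
  rowspan k M = rowspan j M' -> rowspan k (M *m A) = rowspan j (M' *m A).
Proof.
move=> /vspaceP MM'; apply/vspaceP => v; apply/idP/idP => /rowspanP[u -> u0].
  have /rowspanP[w wE w0] : u *m M \in rowspan j M' by rewrite -MM'; apply/rowspanP; exists u.
  by apply/rowspanP; exists w; rewrite // !mulmxA wE.
have /rowspanP[w wE w0] : u *m M' \in rowspan k M by rewrite MM'; apply/rowspanP; exists u.
by apply/rowspanP; exists w; rewrite // !mulmxA wE.
Qed.

Lemma rowspan_mulP (m p : nat) (M : 'M[K]_(m, n)) (M' : 'M[K]_(p, n)) :
  (rowspan m M <= rowspan p M')%VS -> exists B, M = B *m M'.
Proof.
move=> /subvP MM'.
have /fin_all_exists[b bE] : forall i, exists u, row i M = u *m M'.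
  move=> i; apply/rowspan_full/MM'/rowspan_full; exists (delta_mx 0 i).
  by rewrite -rowE.
exists (\matrix_i b i); apply/row_matrixP => i.
by rewrite row_mul rowK bE.
Qed.

Lemma rowspan_mul_sub (m p : nat) (B : 'M[K]_(m, p)) (M : 'M[K]_(p, n)) :
  (rowspan m (B *m M) <= rowspan p M)%VS.
Proof.
apply/subvP => v /rowspan_full[u ->]; apply/rowspan_full; exists (u *m B).
by rewrite mulmxA.
Qed.

Lemma rowspan_unitmxl (m : nat) (B : 'M[K]_m) (M : 'M[K]_(m, n)) :
  B \in unitmx -> rowspan m (B *m M) = rowspan m M.
Proof.
move=> B_unit; apply/eqP; rewrite eqEsubv rowspan_mul_sub /=.
by rewrite -{1}[M](mulKmx B_unit) rowspan_mul_sub.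
Qed.

Lemma size_rowspan (m k : nat) :
  (k <= m)%N -> size [seq i : 'I_m <- enum 'I_m | (i < k)%N] = k.
Proof.
move=> k_le; rewrite -[RHS](card_ltn_ord k_le) cardE; congr size.
by rewrite [in RHS]/enum_mem -enumT; apply: eq_filter => i; rewrite /= inE.
Qed.

Lemma dim_rowspan_le (m k : nat) (M : 'M[K]_(m, n)) :
  (k <= m)%N -> (\dim (rowspan k M) <= k)%N.
Proof.
move=> k_le; rewrite -[leqRHS](size_rowspan k_le) -(size_map (fun i => row i M)).
exact: dim_span.
Qed.

(** All the rows together are free because [u *m M] determines [u]; after a permutation the first
    [k] of them form a prefix of a free family. *)
Lemma dim_rowspan (m k : nat) (M : 'M[K]_(m, n)) :
  row_free M -> (k <= m)%N -> \dim (rowspan k M) = k.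
Proof.
move=> M_free k_le.
have free_M : free [seq row i M | i <- enum 'I_m].
  rewrite /free size_map size_enum_ord.
  have -> : <<[seq row i M | i <- enum 'I_m]>>%VS = (linfun (mulmxr M) @: fullv)%VS.
    apply/vspaceP => v; rewrite -rowspan_all.
    apply/idP/idP => [/rowspan_full[u ->]|/memv_imgP[u _ ->]].
      by apply/memv_imgP; exists u; rewrite ?memvf // lfunE.
    by apply/rowspan_full; exists u; rewrite lfunE.
  rewrite limg_dim_eq ?dimvf ?dim_matrix ?[X in X == _]mul1n ?eqxx //.
  apply/eqP; rewrite -subv0; apply/subvP => u; rewrite memv_cap memv_ker memv0 lfunE /=.
  by move=> /andP[_ /eqP uM]; apply/eqP/(row_free_inj M_free); rewrite mul0mx.
apply/eqP; rewrite -{2}(size_rowspan k_le) -(size_map (fun i => row i M)).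
have := permEl (perm_filterC (fun i : 'I_m => i < k)%N (enum 'I_m)).
move=> /(perm_map (fun i => row i M))/perm_free; rewrite map_cat free_M.
exact: catl_free.
Qed.

(** The rank factorization puts the row span of [M] inside the span of [\rank M] rows, so [m] is at
    most the rank. *)
Lemma row_free_rowspan (m : nat) (M : 'M[K]_(m, n)) :
  \dim (rowspan m M) = m -> row_free M.
Proof.
move=> dimM; rewrite -row_leq_rank -{1}dimM -{1}(mulmx_base M).
exact: leq_trans (dimvS (rowspan_mul_sub _ _)) (dim_rowspan_le _ _).
Qed.

Lemma rowspan_exists (l : nat) (H : {vspace 'rV[K]_n}) :
  \dim H = l -> exists2 M : 'M[K]_(l, n), row_free M & H = rowspan l M.
Proof.
move=> <-; pose M := \matrix_(i < \dim H) (vbasis H)`_i.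
have HM : H = rowspan (\dim H) M.
  rewrite -[LHS](span_basis (vbasisP H)) rowspan_all; congr span.
  apply: (@eq_from_nth _ 0); first by rewrite size_map size_enum_ord size_tuple.
  move=> i; rewrite size_tuple => lt_i.
  rewrite (nth_map (Ordinal lt_i)) ?size_enum_ord // rowK.
  by rewrite nth_enum_ord.
by exists M => //; apply: row_free_rowspan; rewrite -HM.
Qed.

End RowSpan.

Section Reduction.
Variables (K : fieldType) (n l : nat).

Lemma colsub_unit_exists (X : 'M[K]_(l, n)) :
  row_free X -> exists f : {ffun 'I_l -> 'I_n}, colsub f X \in unitmx.
Proof.
rewrite -row_leq_rank -mxrank_tr => X_full.
have X_rf : row_full X^T by rewrite /row_full eqn_leq rank_leq_col.
exists (fullrankfun X_rf); rewrite -unitmx_tr.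
suff -> : (colsub (fullrankfun X_rf) X)^T = rowsub (fullrankfun X_rf) X^T.
  exact: fullrowsub_unit.
by apply/matrixP => i j; rewrite !mxE.
Qed.

(** The rearrangement inequality for two terms, which makes a descent improvable in
    [echelon_exists]. *)
Lemma exchange_lt (x y p q : nat) :
  (p < q)%N -> (y < x)%N -> (x * p.+1 + y * q.+1 < y * p.+1 + x * q.+1)%N.
Proof. nia. Qed.

(* Among the [f] selecting an invertible l x l minor, one maximizing
   [\sum_i f i * i.+1] selects the pivots of the echelon form: a nonzero entry
   right of a pivot, or a descent of [f], would allow a larger sum. *)
Lemma echelon_exists (X : 'M[K]_(l, n)) :
  row_free X ->
  exists a : {ffun 'I_l -> 'I_n}, {homo a : i j / (i < j)%N} /\
  exists (B : 'M[K]_l) (M : 'M[K]_(l, n)),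
    [/\ B \in unitmx, X = B *m M, forall i k, M i (a k) = (i == k)%:R &
        forall i (x : 'I_n), (a i < x)%N -> M i x = 0].
Proof.
move=> /colsub_unit_exists[f0 f0_unit].
pose w (f : {ffun 'I_l -> 'I_n}) := (\sum_(i < l) f i * i.+1)%N.
have [a a_unit a_max] := @arg_maxnP _ f0 (fun f => colsub f X \in unitmx) w f0_unit.
pose M := invmx (colsub a X) *m X.
have XM : X = colsub a X *m M by rewrite mulKVmx.
have Ma i k : M i (a k) = (i == k)%:R.
  have := congr1 (fun A : 'M[K]_l => A i k) (mulVmx a_unit).
  rewrite !mxE => <-; apply: eq_bigr => j _; by rewrite !mxE.
have colsub_unit f : (colsub f X \in unitmx) = (colsub f M \in unitmx).
  by rewrite {1}XM -mulmx_colsub unitmx_mul a_unit.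
clearbody M.
have a_inj : injective a.
  move=> i k e; have := Ma i i; rewrite {1}e Ma.
  by case: eqP => // _ /eqP; rewrite eqxx eq_sym oner_eq0.
exists a; split.
  move=> i k lt_ik; rewrite ltnNge leq_eqVlt; apply/norP; split.
    by apply: contraTneq lt_ik => /val_inj/a_inj ->; rewrite ltnn.
  apply/negP => lt_a.
  pose b := [ffun j => a (tperm i k j)].
  have /a_max : colsub b X \in unitmx.
    have -> : colsub b X = col_perm (tperm i k) (colsub a X).
      by apply/matrixP => x y; rewrite !mxE ffunE.
    by rewrite col_permE unitmx_mul a_unit unitmx_perm.
  rewrite /geq /= leqNgt; apply/negP; rewrite negbK /w.
  have ik : k != i by apply: contraTneq lt_ik => ->; rewrite ltnn.
  rewrite (bigD1 i) // (bigD1 k) //= [X in (_ < X)%N](bigD1 i) // [X in (_ < _ + X)%N](bigD1 k) //=.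
  rewrite !ffunE tpermL tpermR !addnA.
  have -> : (\sum_(j < l | (j != i) && (j != k)) b j * j.+1 =
             \sum_(j < l | (j != i) && (j != k)) a j * j.+1)%N.
    by apply: eq_bigr => j /andP[ji jk]; rewrite ffunE tpermD // eq_sym.
  by rewrite ltn_add2r; apply: exchange_lt.
exists (colsub a X), M; split=> // i x lt_x.
apply/eqP/negP => /negP Mix.
pose b := [ffun j => if j == i then x else a j].
have : colsub b X \in unitmx.
  (* In the columns [b], [M] is the identity except for column [i], whose diagonal entry [M i x] is
     nonzero. *)
  rewrite colsub_unit -row_free_unit; apply/inj_row_free => u /rowP ub.
  have u_neq k : k != i -> u 0 k = 0.
    move=> /negPf ki; have := ub k; rewrite !mxE (bigD1 k) //= !mxE ffunE ki Ma eqxx mulr1.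
    rewrite big1 ?addr0 // => j jk.
    by rewrite mxE ffunE ki Ma (negPf jk) mulr0.
  apply/rowP => k; rewrite [RHS]mxE; have [->|/u_neq //] := eqVneq k i.
  have := ub i; rewrite !mxE (bigD1 i) //= !mxE ffunE eqxx big1 ?addr0 => [/eqP|j /u_neq ->].
    by rewrite mulf_eq0 (negPf Mix) orbF => /eqP.
  by rewrite mul0r.
move/a_max; rewrite /geq /= leqNgt; apply/negP; rewrite negbK /w.
rewrite (bigD1 i) //= [ltnRHS](bigD1 i) //= ffunE eqxx.
have -> : (\sum_(j < l | j != i) b j * j.+1 = \sum_(j < l | j != i) a j * j.+1)%N.
  by apply: eq_bigr => j /negPf ji; rewrite ffunE ji.
by rewrite ltn_add2r ltn_pmul2r.
Qed.

End Reduction.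

(** * Schubert varieties and echelon forms *)

Section Cells.
Variables (K : fieldType) (n l : nat).

(* [schubert_variety], with the sequence given by its 0-based entries. *)
Definition in_schubert (a : 'I_l -> 'I_n) (F : flag K n) (H : {vspace 'rV[K]_n}) : Prop :=
  \dim H = l /\ forall i : 'I_l, (i < \dim (H :&: F (lift ord0 (a i))))%N.

Lemma in_schubertE (s : seq nat) (a : 'I_l -> 'I_n) (F : flag K n) H :
  (forall i, (a i).+1 = nth 0%N s i) ->
  schubert_variety l s F H <-> in_schubert a F H.
Proof.
(* The flag is indexed by dimension, so the 0-based pivot [a i] corresponds to the index [(a i).+1],
   that is, [lift ord0 (a i)]. *)
move=> sE; have pE (i : 'I_l) : inord (nth 0%N s i) = lift ord0 (a i).
  by apply: val_inj; rewrite -sE /= inordK // ltnS.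
by split=> -[dimH posH]; split=> // i; move: (posH i); rewrite pE.
Qed.

Lemma echelon_free_row m (a : 'I_l -> 'I_n) (c : 'I_m -> 'I_n) Q (Phi : 'M[K]_n) :
  complementary a c -> Phi \in unitmx -> row_free (echelon a c Q *m Phi).
Proof.
move=> ac Phi_unit; apply/row_freeP; exists (invmx Phi *m (selmx K a)^T).
by rewrite mulmxA mulmxK // echelon_a.
Qed.

Lemma echelon_right m (a : 'I_l -> 'I_n) (c : 'I_m -> 'I_n) (Q : 'M[K]_(l, m)) i (x : 'I_n) :
  complementary a c -> tri a c Q -> (a i < x)%N -> echelon a c Q i x = 0.
Proof.
move=> ac Qt; have [_ _ _ cov] := ac.
have [[k ->]|[j ->]] := cov x => lt_ax.
  by rewrite echelon_pivot //; case: eqP lt_ax => // ->; rewrite ltnn.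
by rewrite echelon_free // Qt // -leqNgt ltnW.
Qed.

Lemma echelon_intro m (a : 'I_l -> 'I_n) (c : 'I_m -> 'I_n) (M : 'M[K]_(l, n)) :
  complementary a c -> (forall i k, M i (a k) = (i == k)%:R) ->
  (forall i (x : 'I_n), (a i < x)%N -> M i x = 0) ->
  exists2 Q, tri a c Q & M = echelon a c Q.
Proof.
move=> ac Ma Mr; exists (M *m (selmx K c)^T); last exact: echelonP.
move=> i j; rewrite -leqNgt => le_ac; rewrite mul_selmxT Mr // ltn_neqAle le_ac andbT.
by case: ac => _ _ /(_ i j); rewrite -(inj_eq val_inj).
Qed.

(** Rows [0, ..., i] of the echelon matrix vanish right of column [a i], so after multiplication by
    [Phi] they are [i.+1] free vectors of the flag space of dimension [(a i).+1]. *)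
Lemma echelon_in_schubert m (a : 'I_l -> 'I_n) (c : 'I_m -> 'I_n) (Q : 'M[K]_(l, m))
    (Phi : 'M[K]_n) :
  complementary a c -> {homo a : i j / (i < j)%N} -> tri a c Q -> Phi \in unitmx ->
  in_schubert a (flag_of_mx Phi) (rowspan l (echelon a c Q *m Phi)).
Proof.
move=> ac a_incr Qt Phi_unit; have E_free := echelon_free_row Q ac Phi_unit.
split=> [|i]; first exact: dim_rowspan.
rewrite -[X in (X <= _)%N](dim_rowspan E_free (ltn_ord i)); apply: dimvS.
rewrite subv_cap rowspan_le ?ltn_ord //= ffunE; apply: rowspan_sub => j.
rewrite ltnS => le_ji; apply/rowspanP; exists (row j (echelon a c Q)).
  by rewrite row_mul.
move=> x lt_ix; rewrite mxE echelon_right //; apply: leq_trans lt_ix.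
rewrite ltnS /=; move: le_ji; rewrite leq_eqVlt => /orP[/eqP/val_inj->//|/a_incr].
exact: ltnW.
Qed.

(** A Schubert variety is covered by cells with pivots at most [b]. If [b i < a i], a vector of [H]
    in the space of index [(b i).+1] has coefficient 0 on every row [j >= i], as this coefficient is
    its entry at the pivot [a j]; the intersection would then have dimension at most [i]. *)
Lemma in_schubert_echelon (b : 'I_l -> 'I_n) (Phi : 'M[K]_n) H :
  Phi \in unitmx -> in_schubert b (flag_of_mx Phi) H ->
  exists (a : {ffun 'I_l -> 'I_n}) (c : {ffun 'I_(n - l) -> 'I_n}) (Q : 'M[K]_(l, n - l)),
    [/\ complementary a c, {homo a : i j / (i < j)%N}, tri a c Q,
        H = rowspan l (echelon a c Q *m Phi) & forall i, (a i <= b i)%N].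
Proof.
move=> Phi_unit [/rowspan_exists[X X_free HX] posH].
have /echelon_exists[a [a_incr [B [M [B_unit XM Ma Mr]]]]] : row_free (X *m invmx Phi).
  by rewrite /row_free mxrankMfree // row_free_unit unitmx_inv.
have a_inj : injective a.
  by move=> i j e; apply: val_inj; case: (ltngtP i j) => // /a_incr; rewrite e ltnn.
have [c ac] := complementary_exists a_inj.
have [Q Qt ME] := echelon_intro ac Ma Mr.
have HE : H = rowspan l (echelon a c Q *m Phi).
  by rewrite HX -[X](mulmxKV Phi_unit) XM -mulmxA rowspan_unitmxl -?ME.
exists a, c, Q; split=> // i; rewrite leqNgt; apply/negP => lt_ba.
have E_free := echelon_free_row Q ac Phi_unit.
have := posH i; rewrite ltnNge -[X in (_ <= X)%N](dim_rowspan E_free (ltnW (ltn_ord i))).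
move=> /negP[]; apply/dimvS/subvP => v; rewrite memv_cap ffunE HE.
move=> /andP[/rowspan_full[u ->] /rowspanP[w uw w0]].
apply/rowspanP; exists u => // j le_ij.
have uE : u *m echelon a c Q = w.
  by apply: (can_inj (mulmxK Phi_unit)); rewrite -mulmxA.
have -> : u 0 j = (u *m echelon a c Q *m (selmx K a)^T) 0 j.
  by rewrite -mulmxA echelon_a // mulmx1.
rewrite mul_selmxT uE w0 //= /bump /= add1n; apply: leq_trans lt_ba _.
by move: le_ij; rewrite leq_eqVlt => /orP[/eqP/val_inj->//|/a_incr/ltnW].
Qed.

End Cells.

Lemma but_last_lift (r : nat) (i : 'I_r) : but_last i = lift ord_max i.
Proof. by apply: val_inj; rewrite /= /bump leqNgt ltn_ord. Qed.

Lemma complementary_add n l m (a : 'I_l -> 'I_n) (c : 'I_m -> 'I_n) :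
  complementary a c -> (l + m = n)%N.
Proof.
move=> [a_inj c_inj ac cov]; rewrite -(card_ord n) -cardsT.
have -> : [set: 'I_n] = a @: [set: _] :|: c @: [set: _].
  apply/setP => x; rewrite !inE; symmetry; apply/orP.
  by have [[i ->]|[j ->]] := cov x; [left|right]; rewrite imset_f.
by rewrite card_imsetU // !cardsT !card_ord.
Qed.

Lemma card_pair_sig (I J : finType) (P : I -> pred J) :
  #|{: {x : I * J | P x.1 x.2}}| = (\sum_i #|P i|)%N.
Proof.
rewrite card_sig -sum1_card -(pair_big_dep predT P (fun _ _ => 1%N)) /=.
by apply: eq_bigr => i _; rewrite sum1_card.
Qed.

(* The flags in special position are parametrized polynomially: a flag [Phi]
   for which [echelon a c Q *m Phi] spans the row space of [h] is determined
   by [Q], by the coefficients of the former in terms of [h] and by its rows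
   [c]. *)
Lemma special_position_poly (K : fieldType) (n l m r : nat)
    (a : 'I_r.+1 -> 'I_l -> 'I_n) (c : 'I_r.+1 -> 'I_m -> 'I_n) :
  (forall i, complementary (a i) (c i)) ->
  (\sum_i #|[pred p : 'I_l * 'I_m | (c i p.2 < a i p.1)%N]| < r * (l * m))%N ->
  exists2 P : {mpoly K[#|{: 'I_r.+1 * 'I_n * 'I_n}|]}, P != 0 &
    forall (Phi : 'I_r.+1 -> 'M[K]_n) (Q : 'I_r.+1 -> 'M[K]_(l, m)) (A : 'I_r -> 'M[K]_l),
      (forall i, tri (a i) (c i) (Q i)) ->
      (forall i, echelon (a (but_last i)) (c (but_last i)) (Q (but_last i)) *m Phi (but_last i)
         = A i *m (echelon (a ord_max) (c ord_max) (Q ord_max) *m Phi ord_max)) ->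
      P.@[mx_entries Phi] = 0.
Proof.
move=> ac lt_sum.
have nE := complementary_add (ac ord_max).
pose below (i : 'I_r.+1) : pred ('I_l * 'I_m) := fun p => (c i p.2 < a i p.1)%N.
pose T : finType := ({x : 'I_r.+1 * ('I_l * 'I_m) | below x.1 x.2} + 'I_r * ('I_l * 'I_l)
  + 'I_r * ('I_m * 'I_n) + 'I_n * 'I_n)%type.
(* With [t < r * (l * m)] for the first summand and [n = l + m], the count [t + r l^2 + r m n + n^2]
   is below [(r + 1) n^2]. *)
have card_T : (#|T| < #|{: 'I_r.+1 * 'I_n * 'I_n}|)%N.
  rewrite !card_sum (card_pair_sig below) !card_prod !card_ord -nE.
  move: lt_sum; rewrite (eq_bigr (fun i => #|below i|)) //; move: (\sum_i _)%N => t; nia.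
(* The default 0 off [below] agrees with [tri]. *)
pose Qx i (x : T -> K) : 'M[K]_(l, m) := \matrix_(p, q)
  if insub (i, (p, q)) is Some t then x (inl (inl (inl t))) else 0.
pose Ax i (x : T -> K) : 'M[K]_l := \matrix_(p, q) x (inl (inl (inr (i, (p, q))))).
pose Bx i (x : T -> K) : 'M[K]_(m, n) := \matrix_(p, q) x (inl (inr (i, (p, q)))).
pose Lx (x : T -> K) : 'M[K]_n := \matrix_(p, q) x (inr (p, q)).
pose h x := echelon (a ord_max) (c ord_max) (Qx ord_max x) *m Lx x.
(* The rows [c] of the matrix are the parameters [Bx]; the relation [S_a Phi + Q S_c Phi = A h]
   yields its rows [a]. *)
pose Px i x := (selmx K (a (but_last i)))^T *m (Ax i x *m h x - Qx (but_last i) x *m Bx i x)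
  + (selmx K (c (but_last i)))^T *m Bx i x.
pose F x k := if unlift ord_max k is Some i then Px i x else Lx x.
have Qp i : polymx (Qx i).
  move=> p q; case e: (insub (i, (p, q)) : option {x | below x.1 x.2}) => [t|].
    by have [P PE] := polyfunX K (inl (inl (inl t)) : T); exists P => x; rewrite mxE e.
  by have [P PE] := @polyfunC K T 0; exists P => x; rewrite mxE e.
have Ap i : polymx (Ax i).
  move=> p q; have [P PE] := polyfunX K (inl (inl (inr (i, (p, q)))) : T).
  by exists P => x; rewrite mxE.
have Bp i : polymx (Bx i).
  move=> p q; have [P PE] := polyfunX K (inl (inr (i, (p, q))) : T).
  by exists P => x; rewrite mxE.
have Lp : polymx Lx.
  move=> p q; have [P PE] := polyfunX K (inr (p, q) : T).
  by exists P => x; rewrite mxE.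
have hp : polymx h.
  by apply: polymxM => //; apply: polymxD; [apply: polymxC|apply: polymxM => //; apply: polymxC].
have Pp i : polymx (Px i).
  apply: polymxD; apply: polymxM => //; try exact: polymxC.
  by apply: polymxD; [exact: polymxM|apply: polymxN; exact: polymxM].
have Fp k : polymx (F^~ k) by rewrite /F; case: unlift.
have [P P0 PF] := polyfun_image
  (fun k => Fp (enum_val k).1.1 (enum_val k).1.2 (enum_val k).2) card_T.
exists P => // Phi Q A Qt eqPhi.
pose x (t : T) := match t with
  | inl (inl (inl s)) => Q (val s).1 (val s).2.1 (val s).2.2
  | inl (inl (inr s)) => A s.1 s.2.1 s.2.2
  | inl (inr s) => (selmx K (c (but_last s.1)) *m Phi (but_last s.1)) s.2.1 s.2.2
  | inr s => Phi ord_max s.1 s.2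
  end.
have QxE i : Qx i x = Q i.
  apply/matrixP => p q; rewrite mxE; case: insubP => [t _ tE|]; first by rewrite /x /= tE.
  by move=> /Qt ->.
have LxE : Lx x = Phi ord_max by apply/matrixP => p q; rewrite mxE.
have AxE i : Ax i x = A i by apply/matrixP => p q; rewrite mxE.
have BxE i : Bx i x = selmx K (c (but_last i)) *m Phi (but_last i).
  by apply/matrixP => p q; rewrite mxE.
rewrite -(PF x); apply: meval_eq => k; rewrite /mx_entries; congr (fun_of_matrix _ _ _).
rewrite /F; case: unliftP => [i|] -> //; rewrite -but_last_lift /Px AxE BxE QxE /h QxE LxE.
rewrite -eqPhi mulmxDl mulmxA addrK !mulmxA -mulmxDl.
by rewrite selmx_sum // mul1mx.
Qed.

(** * Generic flags *)

(** For increasing [b i], the inner sum is the dimension of the Schubert variety of [b i]. The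
    inequality says that varieties with a common point have codimensions adding up to at most the
    dimension of the Grassmannian. *)
Definition generic_flags (K : fieldType) (n l r : nat) (F : 'I_r.+1 -> flag K n) : Prop :=
  forall (b : 'I_r.+1 -> 'I_l -> 'I_n) H,
    (forall i, in_schubert (b i) (F i) H) -> (r * (l * (n - l)) <= \sum_i \sum_j (b i j - j))%N.

(** There are finitely many choices of pivots, so the relations of [special_position_poly] can be
    multiplied together. A common point of Schubert varieties of too small total dimension lies in
    cells of no larger total dimension, and the factor for their pivots vanishes. *)
Lemma generic_flags_poly (K : fieldType) (n l r : nat) :
  exists2 P : {mpoly K[#|{: 'I_r.+1 * 'I_n * 'I_n}|]}, P != 0 &
    forall Phi : 'I_r.+1 -> 'M[K]_n, (forall i, Phi i \in unitmx) ->
      P.@[mx_entries Phi] != 0 -> generic_flags l (fun i => flag_of_mx (Phi i)).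
Proof.
pose pivots := {ffun 'I_r.+1 -> {ffun 'I_l -> 'I_n} * {ffun 'I_(n - l) -> 'I_n}}.
have /fin_all_exists[P PP] (p : pivots) :
  exists P : {mpoly K[#|{: 'I_r.+1 * 'I_n * 'I_n}|]}, P != 0 /\
    ((forall i, complementary (p i).1 (p i).2) ->
     (\sum_i #|[pred q : 'I_l * 'I_(n - l) | ((p i).2 q.2 < (p i).1 q.1)%N]|
        < r * (l * (n - l)))%N ->
    forall (Phi : 'I_r.+1 -> 'M[K]_n) (Q : 'I_r.+1 -> 'M[K]_(l, n - l)) (A : 'I_r -> 'M[K]_l),
      (forall i, tri (p i).1 (p i).2 (Q i)) ->
      (forall i, echelon (p (but_last i)).1 (p (but_last i)).2 (Q (but_last i))
                   *m Phi (but_last i)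
         = A i *m (echelon (p ord_max).1 (p ord_max).2 (Q ord_max) *m Phi ord_max)) ->
      P.@[mx_entries Phi] = 0).
  have [[pc lt_p]|np] := pselect ((forall i, complementary (p i).1 (p i).2) /\
    (\sum_i #|[pred q : 'I_l * 'I_(n - l) | ((p i).2 q.2 < (p i).1 q.1)%N]|
        < r * (l * (n - l)))%N).
    by have [P P0 PE] := special_position_poly K pc lt_p; exists P.
  (* Pivots to which the relation does not apply contribute the factor 1. *)
  by exists 1; split=> [|pc lt_p]; [exact: oner_neq0|case: np].
exists (\prod_p P p); first by apply/prodf_neq0 => p _; case: (PP p).
move=> Phi Phi_unit; rewrite rmorph_prod /= => /prodf_neq0 P_neq0 b H bH.
have /fin_all_exists[p /fin_all_exists[Q pQ]] : forall i, exists
  (p : {ffun 'I_l -> 'I_n} * {ffun 'I_(n - l) -> 'I_n}) (Q : 'M[K]_(l, n - l)),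
    [/\ complementary p.1 p.2, {homo p.1 : i j / (i < j)%N}, tri p.1 p.2 Q,
        H = rowspan l (echelon p.1 p.2 Q *m Phi i) & forall j, (p.1 j <= b i j)%N].
  move=> i; have [a [c [Q aQ]]] := in_schubert_echelon (Phi_unit i) (bH i).
  by exists (a, c), Q.
have le_b : (\sum_i #|[pred q : 'I_l * 'I_(n - l) | ((p i).2 q.2 < (p i).1 q.1)%N]|
    <= \sum_i \sum_j (b i j - j))%N.
  apply: leq_sum => i _; have [ac a_incr _ _ le_ab] := pQ i.
  by rewrite card_tri //; apply: leq_sum => j _; rewrite leq_sub2r.
apply: leq_trans le_b; rewrite leqNgt; apply/negP => lt_p.
have [_ PE] := PP (finfun p).
have /fin_all_exists[A EA] (i : 'I_r) : exists A,
    echelon (p (but_last i)).1 (p (but_last i)).2 (Q (but_last i)) *m Phi (but_last i)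
    = A *m (echelon (p ord_max).1 (p ord_max).2 (Q ord_max) *m Phi ord_max).
  apply: rowspan_mulP; have [_ _ _ <- _] := pQ (but_last i).
  by have [_ _ _ <- _] := pQ ord_max.
have /eqP := P_neq0 (finfun p) isT; apply; apply: (PE _ _ Phi Q A).
- by move=> i; rewrite ffunE; case: (pQ i).
- by under eq_bigr do rewrite ffunE.
- by move=> i; rewrite ffunE; case: (pQ i).
by move=> i; rewrite !ffunE EA.
Qed.

Section FlagsOfMatrices.
Variables (K : fieldType) (n : nat).

Lemma flag_of_mx_complete (Phi : 'M[K]_n) : Phi \in unitmx -> complete_flag (flag_of_mx Phi).
Proof.
move=> Phi_unit; split=> [k|j k le_jk]; rewrite !ffunE; last exact: rowspan_le.
by rewrite dim_rowspan ?row_free_unit // -ltnS.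
Qed.

(** Row [k] is chosen in the space of dimension [k.+1] but outside that of dimension [k]; each new
    row then raises the dimension of the span, which fills the flag by induction. *)
Lemma complete_flag_mx (F : flag K n) :
  complete_flag F -> exists2 Phi : 'M[K]_n, Phi \in unitmx & F = flag_of_mx Phi.
Proof.
move=> [dimF subF].
pose w (k : 'I_n) : 'I_n.+1 := widen_ord (leqnSn n) k.
have /fin_all_exists2[v vF vnF] (k : 'I_n) :
    exists2 v, v \in F (lift ord0 k) & v \notin F (w k).
  apply/subvPn; apply/negP => /dimvS; rewrite !dimF /= /bump /= add1n ltnn.
  by [].
pose Phi : 'M[K]_n := \matrix_k v k.
have PhiF k : (k < n.+1)%N -> rowspan k Phi = F (inord k).
  elim: k => [|k IHk] lt_k.
    have -> : F (inord 0) = 0%VS by apply/eqP; rewrite -dimv_eq0 dimF inordK.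
    apply/eqP; rewrite -dimv_eq0 -leqn0; exact: dim_rowspan_le.
  have lt_kn : (k < n)%N by [].
  have wE : inord k = w (Ordinal lt_kn) by apply: val_inj; rewrite /= inordK // ltnW.
  apply/eqP; rewrite eqEdim dimF inordK //; apply/andP; split.
    apply: rowspan_sub => i; rewrite ltnS => le_ik; rewrite rowK.
    by apply: (subvP (subF _ _ _) _ (vF i)); rewrite /= /bump /= add1n inordK // ltnS.
  have lt_dim : (\dim (rowspan k Phi) < \dim (rowspan k.+1 Phi))%N.
    rewrite ltnNge; apply/negP => le_dim.
    have : (rowspan k Phi == rowspan k.+1 Phi) by rewrite eqEdim le_dim rowspan_le.
    rewrite (IHk (ltnW lt_k)) wE => /eqP Fk; have := vnF (Ordinal lt_kn).
    rewrite Fk => /negP[]; apply/rowspanP; exists (delta_mx 0 (Ordinal lt_kn)).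
      by rewrite -rowE rowK.
    move=> j lt_kj; rewrite mxE eqxx /=; case: eqP lt_kj => // ->.
    by rewrite ltnn.
  by apply: leq_ltn_trans lt_dim; rewrite (IHk (ltnW lt_k)) dimF inordK ?leqnn // ltnW.
exists Phi; last by apply/ffunP => k; rewrite ffunE PhiF // inord_val.
by rewrite -row_free_unit; apply: row_free_rowspan; rewrite PhiF // dimF inordK.
Qed.

End FlagsOfMatrices.

(* The flags of [Psi] and of [Phi] agree iff [Psi *m invmx Phi] is lower
   triangular, and left multiplication by the latter does not change flags. *)
Lemma flag_of_mx_translate (K : fieldType) (n : nat) (Psi Phi Phi' : 'M[K]_n) :
  Phi \in unitmx -> flag_of_mx Psi = flag_of_mx Phi ->
  flag_of_mx (Psi *m invmx Phi *m Phi') = flag_of_mx Phi'.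
Proof.
move=> Phi_unit /ffunP eqF; apply/ffunP => k; have := eqF k; rewrite !ffunE => eqk.
have := eq_rowspan_mulr (invmx Phi *m Phi') eqk.
by rewrite !mulmxA mulmxV // mul1mx.
Qed.

(** * Open dense sets of tuples of flags *)

Section OpenDense.
Variables (K : numFieldType) (n s : nat).
Let entries := #|{: 'I_s * 'I_n * 'I_n}|.
Variable P : {mpoly K[entries]}.

(** The value of [P] depends on the matrices and not just on their flags, hence the quantifier over
    representatives. *)
Definition flags_nonzero : set ('I_s -> flag K n) :=
  [set F | exists Phi : 'I_s -> 'M[K]_n,
     [/\ forall i, Phi i \in unitmx, forall i, F i = flag_of_mx (Phi i) &
         P.@[mx_entries Phi] != 0]]%classic.

(** If [Psi] represents the flags of [Phi] and [P] is nonzero at [Psi], translating [P] by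
    [b = Psi Phi^-1] gives a polynomial nonzero at [Phi]. Wherever it is nonzero at some [Phi'], the
    matrices [b Phi'] represent the flags of [Phi']. *)
Lemma flags_nonzero_open : flags_zariski_open flags_nonzero.
Proof.
split=> [F [Phi [Phi_unit FE _]] i|]; first by rewrite FE; apply: flag_of_mx_complete.
(* Taking all polynomials whose nonvanishing implies membership makes one direction immediate. *)
exists [set p | forall Phi : 'I_s -> 'M[K]_n, (forall i, Phi i \in unitmx) ->
  p.@[mx_entries Phi] != 0 -> flags_nonzero (fun i => flag_of_mx (Phi i))]%classic.
move=> Phi Phi_unit; split=> [[Psi [Psi_unit PsiF PPsi]]|[p]]; last exact.
pose b i := Psi i *m invmx (Phi i).
pose X : 'I_entries -> {mpoly K[entries]} := fun k => let e := enum_val k in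
  \sum_z b e.1.1 e.1.2 z *: 'X_(enum_rank (e.1.1, z, e.2)).
have PX (Phi' : 'I_s -> 'M[K]_n) : (P \mPo [tuple X k | k < entries]).@[mx_entries Phi']
    = P.@[mx_entries (fun i => b i *m Phi' i)].
  rewrite comp_mpoly_meval; apply: meval_eq => k; rewrite tnth_mktuple /X raddf_sum /=.
  rewrite [RHS]mxE; apply: eq_bigr => z _.
  by rewrite mevalZ mevalXU /mx_entries enum_rankK.
exists (P \mPo [tuple X k | k < entries]); last first.
  rewrite PX; suff -> : (fun i => b i *m Phi i) = Psi by [].
  by apply: funext => i; rewrite mulmxKV.
move=> Phi' Phi'_unit PPhi'; exists (fun i => b i *m Phi' i); split=> [i|i|].
- by rewrite !unitmx_mul unitmx_inv Psi_unit Phi_unit Phi'_unit.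
- by rewrite flag_of_mx_translate // PsiF.
by rewrite -PX.
Qed.

(** A nonempty open [W] has a nonzero polynomial [p] witnessing membership; a point where [P], [p]
    and all determinants are nonzero gives flags in both sets. *)
Lemma flags_nonzero_dense : P != 0 -> flags_zariski_dense flags_nonzero.
Proof.
move=> P_neq0 W [W_complete [S WS]] [F0 WF0].
have /fin_all_exists2[Phi0 Phi0_unit F0E] i := complete_flag_mx (W_complete _ WF0 i).
have F0_eq : F0 = fun i => flag_of_mx (Phi0 i) by apply: funext => i.
move: WF0; rewrite F0_eq => /(WS _ Phi0_unit)[p Sp p_neq0].
pose D : {mpoly K[entries]} :=
  \prod_i \det (\matrix_(x, y) 'X_(enum_rank (i, x, y))).
have DE (Phi : 'I_s -> 'M[K]_n) : D.@[mx_entries Phi] = \prod_i \det (Phi i).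
  rewrite rmorph_prod; apply: eq_bigr => i _ /=; rewrite -det_map_mx; congr (\det _).
  by apply/matrixP => x y; rewrite !mxE /= mevalXU /mx_entries enum_rankK.
(* The product of generic determinants is nonzero because its value at [Phi0] is. *)
have D_neq0 : D != 0.
  apply/eqP => D0; have := DE Phi0; rewrite D0 meval0 => /esym/eqP/prodf_eq0[i _ /eqP det0].
  by have := Phi0_unit i; rewrite unitmxE det0 unitr0.
have pp_neq0 : p != 0 by apply: contraNneq p_neq0 => ->; rewrite meval0.
have [v] := mpoly_nonroot (mulf_neq0 (mulf_neq0 P_neq0 pp_neq0) D_neq0).
pose Phi i : 'M[K]_n := \matrix_(x, y) v (enum_rank (i, x, y)).
have vE : v = mx_entries Phi.
  apply: funext => k; rewrite /mx_entries mxE -!surjective_pairing enum_valK.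
  by [].
rewrite vE !mevalM DE !mulf_eq0 !negb_or => /andP[/andP[PPhi pPhi] /prodf_neq0 det_neq0].
have Phi_unit i : Phi i \in unitmx by rewrite unitmxE unitfE det_neq0.
exists (fun i => flag_of_mx (Phi i)); split; first by exists Phi.
by apply/(WS _ Phi_unit); exists p.
Qed.

End OpenDense.

(** * Local coordinates *)

Definition pivots_of (n l : nat) (s : seq nat) (a : 'I_l -> 'I_n) (c : 'I_(n - l) -> 'I_n) :=
  [/\ complementary a c, {homo a : i j / (i < j)%N},
      forall i : 'I_l, nth 0%N s i = (a i).+1 &
      forall j : 'I_(n - l), cpivot n (n - l) (perp n s) j = (c j).+1].

(** The reflection [y -> n + 1 - y] in [cpivot] undoes the one in [perp], so the pivots of the
    second kind are exactly the columns not in [s]. *)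
Lemma incr_seq_pivots (n l : nat) (s : seq nat) :
  (l <= n)%N -> incr_seq n l s ->
  exists (a : {ffun 'I_l -> 'I_n}) (c : {ffun 'I_(n - l) -> 'I_n}), pivots_of s a c.
Proof.
move=> le_ln /and3P[/eqP size_s sorted_s /allP s_le].
have uniq_s : uniq s := sorted_uniq ltn_trans ltnn sorted_s.
have /fin_all_exists[a aE] (i : 'I_l) : exists x : 'I_n, nth 0%N s i = x.+1.
  have /s_le/andP[] : nth 0%N s i \in s by rewrite mem_nth // size_s.
  by case: (nth 0%N s i) => // x _ lt_x; exists (Ordinal lt_x).
have perp_in y : y \in perp n s -> (0 < y <= n)%N /\ (n.+1 - y)%N \notin s.
  by rewrite mem_filter mem_iota add1n ltnS => /andP[].
have size_perp : size (perp n s) = (n - l)%N.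
  (* [perp n s] is the complement in [1, ..., n] of the reflected sequence [s'], which has [l]
     distinct elements. *)
  pose s' := [seq n.+1 - y | y <- s]%N.
  have s'_in j : j \in iota 1 n -> ((n.+1 - j)%N \in s) = (j \in s').
    rewrite mem_iota => j_in; apply/idP/mapP => [js|[y /[dup] /s_le y_le ys ->]].
      by exists (n.+1 - j)%N => //; lia.
    by rewrite subKn //; lia.
  have /perm_size : perm_eq [seq j <- iota 1 n | j \in s'] s'.
    apply: uniq_perm; rewrite ?filter_uniq ?iota_uniq //.
      by rewrite map_inj_in_uniq // => y y' /s_le y_le /s_le y'_le; lia.
    move=> j; rewrite mem_filter; apply: andb_idr => /mapP[y /s_le y_le ->].
    by rewrite mem_iota; lia.
  rewrite size_map size_s size_filter => count_s'.
  rewrite /perp size_filter (@eq_in_count _ _ (predC (mem s'))); last first.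
    by move=> j /s'_in /= ->.
  have count_l : count (mem s') (iota 1 n) = l by exact: count_s'.
  by rewrite -[n in RHS](size_iota 1) -(count_predC (mem s')) count_l addKn.
have pos_lt (j : 'I_(n - l)) : (n - l - j.+1 < size (perp n s))%N.
  by rewrite size_perp; have := ltn_ord j; lia.
have /fin_all_exists[c cE] (j : 'I_(n - l)) :
    exists x : 'I_n, cpivot n (n - l) (perp n s) j = x.+1.
  have [/andP[y_gt0 y_le] _] := perp_in _ (mem_nth 0%N (pos_lt j)).
  have lt_x : (n - nth 0%N (perp n s) (n - l - j.+1) < n)%N.
    by rewrite ltn_subrL y_gt0 (leq_trans y_gt0 y_le).
  by exists (Ordinal lt_x); rewrite /cpivot subSn.
exists (finfun a), (finfun c); split.
- apply: complementary_card; last by rewrite subnKC.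
  + move=> i j; rewrite !ffunE => /(congr1 (fun x : 'I_n => x.+1)); rewrite -!aE => /eqP.
    by rewrite nth_uniq ?size_s // => /eqP/val_inj.
  + move=> i j; rewrite !ffunE => /(congr1 (fun x : 'I_n => x.+1)); rewrite -!cE /cpivot.
    have [/andP[yi_gt0 yi_le] _] := perp_in _ (mem_nth 0%N (pos_lt i)).
    have [/andP[yj_gt0 yj_le] _] := perp_in _ (mem_nth 0%N (pos_lt j)).
    move=> e; have /eqP : nth 0%N (perp n s) (n - l - i.+1) = nth 0%N (perp n s) (n - l - j.+1).
      by apply/eqP; move: e yi_le yj_le; move: (nth _ _ _) (nth _ _ _) => u v; clear; lia.
    rewrite nth_uniq // ?filter_uniq ?iota_uniq // => /eqP ij; apply: val_inj.
    by have := ltn_ord i; have := ltn_ord j; rewrite /=; lia.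
  move=> i j; rewrite !ffunE; apply/eqP => /(congr1 (fun x : 'I_n => x.+1)).
  rewrite -aE -cE /cpivot => e.
  have [_ /negP[]] := perp_in _ (mem_nth 0%N (pos_lt j)).
  by rewrite -e mem_nth // size_s.
- move=> i j lt_ij; rewrite !ffunE -ltnS -!aE.
  by apply: (sorted_ltn_nth ltn_trans) => //; rewrite inE size_s.
- by move=> i; rewrite ffunE aE.
by move=> j; rewrite ffunE cE.
Qed.

Section Coordinates.
Variables (K : fieldType) (n l : nat) (s : seq nat).
Variables (a : 'I_l -> 'I_n) (c : 'I_(n - l) -> 'I_n).
Hypothesis sP : pivots_of s a c.

Let acP : complementary a c. Proof. by case: sP. Qed.

Lemma MlowerE (M : 'M[K]_(l, n)) :
  Mlower s M <-> exists2 Q, tri a c Q & M = echelon a c Q.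
Proof.
have [_ _ sa _] := sP; split=> [MP|[Q Qt ->] i x].
  apply: echelon_intro => // [i k|i x lt_x].
    have [M1 _ M0] := MP k (a k); case: (eqVneq i k) => [->|ik]; first by rewrite M1 ?sa.
    by rewrite M0 ?sa.
  by have [_ -> //] := MP i x; rewrite sa.
have [a_inj _ _ _] := acP; rewrite sa; split.
- by move=> [/val_inj->]; rewrite echelon_pivot // eqxx.
- by rewrite ltnS => lt_x; rewrite echelon_right.
by move=> k ki [/val_inj->]; rewrite echelon_pivot // (negPf ki).
Qed.

(** The entry in row [a i] and column [j] is forced to be 0 when [a i < c j], so the shape [tri] of
    the echelon matrices appears again, up to the sign of [Q]. *)
Lemma NcoordE (N : 'M[K]_(n, n - l)) :
  Ncoord l s N <-> exists2 Q, tri a c Q & N = coechelon a c Q.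
Proof.
have [_ _ _ sc] := sP; split=> [[W WP <-]|[Q Qt ->]].
  exists (- (selmx K a *m W^T)); last first.
    apply: coechelonP => // j k; rewrite mxE.
    have [M1 _ M0] := WP j (c j); case: (eqVneq j k) => [<-|jk]; first by rewrite M1 ?sc.
    by rewrite M0 ?sc // eq_sym.
  move=> i j; rewrite -leqNgt => le_ac; rewrite mxE mul_selmx mxE.
  have [_ -> //] := WP j (a i); first by rewrite oppr0.
  rewrite sc ltnS ltn_neqAle le_ac andbT.
  by case: acP => _ _ /(_ i j) + _; rewrite -(inj_eq val_inj).
exists (coechelon a c Q)^T; last by rewrite trmxK.
have [_ c_inj _ cov] := acP.
move=> j x; rewrite sc; split.
- by move=> [/val_inj->]; rewrite mxE coechelon_pivot // eqxx.
- rewrite ltnS => lt_x; rewrite mxE; have [[i xE]|[k xE]] := cov x; rewrite xE in lt_x *.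
    by rewrite coechelon_free // Qt ?oppr0 // -leqNgt ltnW.
  by rewrite coechelon_pivot //; case: eqP lt_x => // ->; rewrite ltnn.
by move=> k kj [/val_inj->]; rewrite mxE coechelon_pivot // eq_sym (negPf kj).
Qed.

Lemma Mlower_freeP (i : 'I_l) (x : 'I_n) :
  Mlower_free s (i, x) <-> exists2 j, x = c j & (c j < a i)%N.
Proof.
have [_ _ sa _] := sP; have [_ _ ac cov] := acP; rewrite /Mlower_free /= sa ltnS; split.
  move=> /andP[lt_x /forallP x_na]; have [[k xE]|[j xE]] := cov x.
    by have := x_na k; rewrite xE sa eqxx.
  by exists j; rewrite -?xE.
move=> [j -> ->]; apply/forallP => k; rewrite sa eqSS eq_sym.
by have := ac k j; rewrite -(inj_eq val_inj).
Qed.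

Lemma Ncoord_freeP (x : 'I_n) (j : 'I_(n - l)) :
  Ncoord_free s (x, j) <-> exists2 i, x = a i & (c j < a i)%N.
Proof.
have [_ _ _ sc] := sP; have [_ _ ac cov] := acP.
rewrite /Ncoord_free /Mupper_free /= sc ltnS; split.
  move=> /andP[lt_x /forallP x_nc]; have [[i xE]|[k xE]] := cov x.
    by exists i; rewrite -?xE.
  by have := x_nc k; rewrite xE sc eqxx.
move=> [i -> ->]; apply/forallP => k; rewrite sc eqSS.
by have := ac i k; rewrite -(inj_eq val_inj).
Qed.

Let below : {set 'I_l * 'I_(n - l)} := [set p | c p.2 < a p.1]%N.

Let card_below : #|below| = (\sum_i (a i - i))%N.
Proof. by have [_ a_incr _ _] := sP; rewrite -(card_tri acP a_incr) cardsE. Qed.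

(** Undoing the truncated subtraction of [codim] requires the sum to be at most [l * (n - l)]; it
    counts a subset of ['I_l * 'I_(n - l)]. *)
Lemma codimE : (\sum_i (a i - i) = l * (n - l) - codim n l s)%N.
Proof.
have [_ _ sa _] := sP.
have -> : codim n l s = (l * (n - l) - \sum_i (a i - i))%N.
  by congr (_ - _)%N; apply: eq_bigr => i _; rewrite sa subSS.
rewrite subKn // -card_below -[X in (_ <= X * _)%N]card_ord -[X in (_ <= _ * X)%N]card_ord.
by rewrite -card_prod max_card.
Qed.

Lemma card_Mlower_free : #|@Mlower_free n l s| = (l * (n - l) - codim n l s)%N.
Proof.
have [_ c_inj _ _] := acP.
rewrite -codimE -card_below -(@card_imset _ _ (fun p => (p.1, c p.2))); last first.
  by move=> [i j] [i' j'] /= [-> /c_inj ->].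
apply: eq_card => -[i x]; apply/idP/imsetP => [/Mlower_freeP[j -> lt_j]|[[i' j]]].
  by exists (i, j); rewrite ?inE.
by rewrite inE /= => lt_j [-> ->]; apply/Mlower_freeP; exists j.
Qed.

Lemma card_Ncoord_free : #|@Ncoord_free n l s| = (l * (n - l) - codim n l s)%N.
Proof.
have [a_inj _ _ _] := acP.
rewrite -codimE -card_below -(@card_imset _ _ (fun p => (a p.1, p.2))); last first.
  by move=> [i j] [i' j'] /= [/a_inj -> ->].
apply: eq_card => -[x j]; apply/idP/imsetP => [/Ncoord_freeP[i -> lt_j]|[[i j']]].
  by exists (i, j); rewrite ?inE.
by rewrite inE /= => lt_j [-> ->]; apply/Ncoord_freeP; exists i.
Qed.

End Coordinates.

Lemma incr_ge_id n l (a : 'I_l -> 'I_n) :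
  {homo a : i j / (i < j)%N} -> forall i : 'I_l, (i <= a i)%N.
Proof.
move=> a_incr [k lt_k] /=; elim: k lt_k => // k IHk lt_k.
exact: leq_ltn_trans (IHk (ltnW lt_k)) (a_incr (Ordinal _) (Ordinal lt_k) (ltnSn k)).
Qed.

(** * Bidegrees *)

Section MultiDegree.
Variables (K : fieldType) (N : nat) (A B : pred 'I_N).

(** [bilinear_poly] is the case [d = e = 1]; general bounds are needed for the factors of a
    product. *)
Definition bidegree_le (d e : nat) (p : {mpoly K[N]}) : Prop :=
  forall m, m \in msupp p ->
    [/\ (\sum_(k | A k) m k <= d)%N, (\sum_(k | B k) m k <= e)%N &
        forall k, ~~ A k -> ~~ B k -> m k = 0%N].

Lemma bidegree_leC d e (x : K) : bidegree_le d e x%:MP.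
Proof.
move=> m; rewrite msuppC; case: ifP => // _; rewrite inE => /eqP->.
by split=> [||k _ _]; rewrite ?mnmE // big1 // => k _; rewrite mnmE.
Qed.

Lemma bidegree_leX d e (k : 'I_N) :
  (A k <= d)%N -> (B k <= e)%N -> A k || B k -> bidegree_le d e 'X_k.
Proof.
have sumU (C : pred 'I_N) : (\sum_(j | C j) (U_(k)%MM : 'X_{1..N}) j = C k)%N.
  rewrite big_mkcond (bigD1 k) //= big1 => [|j jk].
    by rewrite addn0 mnm1E eqxx; case: (C k).
  by rewrite mnm1E eq_sym (negPf jk); case: (C j).
move=> Ad Be AB m; rewrite msuppX inE => /eqP->; split; rewrite ?sumU // => j Aj Bj.
by rewrite mnm1E; case: eqP AB => // ->; rewrite (negPf Aj) (negPf Bj).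
Qed.

Lemma bidegree_leM d e d' e' (p q : {mpoly K[N]}) :
  bidegree_le d e p -> bidegree_le d' e' q -> bidegree_le (d + d') (e + e') (p * q).
Proof.
move=> pP qP m /msuppM_le /allpairsP[[x y] /= [/pP[xA xB x0] /qP[yA yB y0] ->]].
have sumD (C : pred 'I_N) :
    (\sum_(k | C k) (x + y)%MM k = \sum_(k | C k) x k + \sum_(k | C k) y k)%N.
  by rewrite -big_split; apply: eq_bigr => k _; rewrite mnmDE.
by split; rewrite ?sumD ?leq_add // => k Ak Bk; rewrite mnmDE x0 ?y0.
Qed.

Lemma bidegree_le_sum d e (I : finType) (F : I -> {mpoly K[N]}) :
  (forall i, bidegree_le d e (F i)) -> bidegree_le d e (\sum_i F i).
Proof.
move=> FP; apply: big_ind => [|p q pP qP|//].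
- by move=> m; rewrite msupp0.
by move=> m /msuppD_le; rewrite mem_cat => /orP[/pP|/qP].
Qed.

End MultiDegree.

(** * The square system *)

Section System.
Variables (K : fieldType) (n l r : nat) (alpha : 'I_r.+1 -> seq nat).
Variables (a : 'I_r.+1 -> 'I_l -> 'I_n) (c : 'I_r.+1 -> 'I_(n - l) -> 'I_n).
Hypothesis alpha_piv : forall i, pivots_of (alpha i) (a i) (c i).

Let ac i : complementary (a i) (c i). Proof. by case: (alpha_piv i). Qed.

Lemma nvarsE : nvars n l alpha = (\sum_i (l * (n - l) - codim n l (alpha i)))%N.
Proof.
rewrite /nvars card_sig -sum1_card big_sumType /= big_ord_recr addnC /=; congr addn; last first.
  by rewrite sum1_card -(card_Mlower_free (alpha_piv ord_max)); apply: eq_card => p.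
rewrite -(pair_big_dep predT (fun i p => Ncoord_free (alpha (but_last i)) p) (fun _ _ => 1%N)).
by apply: eq_bigr => i _; rewrite sum1_card -(card_Ncoord_free (alpha_piv (but_last i))).
Qed.

Local Notation mx_point := (point n l r K).

Definition coord_point (Q : 'I_r.+1 -> 'M[K]_(l, n - l)) : mx_point :=
  (echelon (a ord_max) (c ord_max) (Q ord_max),
   [ffun i => coechelon (a (but_last i)) (c (but_last i)) (Q (but_last i))]).

Lemma local_coordinatesE (z : mx_point) :
  local_coordinates alpha z <->
  exists2 Q, (forall i, tri (a i) (c i) (Q i)) & z = coord_point Q.
Proof.
split=> [[/(MlowerE (alpha_piv _))[Q0 Q0t z1E] zN]|[Q Qt ->]]; last first.
  split=> [|i]; first by apply/(MlowerE (alpha_piv _)); exists (Q ord_max).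
  by rewrite ffunE; apply/(NcoordE (alpha_piv _)); exists (Q (but_last i)).
have /fin_all_exists2[Q Qt QE] i := (NcoordE (alpha_piv _) _).1 (zN i).
exists (fun k => if unlift ord_max k is Some i then Q i else Q0) => [k|].
  by case: unliftP => [i|] ->; rewrite -?but_last_lift.
case: z z1E {zN} QE => M N /= -> NE; congr pair; first by rewrite unlift_none.
by apply/ffunP => i; rewrite NE ffunE but_last_lift liftK.
Qed.

Lemma free_values_inl (z : mx_point) (v : var n l alpha) p :
  val v = inl p -> free_values alpha z 0 (enum_rank v) = z.1 p.1 p.2.
Proof. by move=> vE; rewrite mxE enum_rankK vE. Qed.

Lemma free_values_inr (z : mx_point) (v : var n l alpha) q :
  val v = inr q -> free_values alpha z 0 (enum_rank v) = z.2 q.1 q.2.1 q.2.2.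
Proof. by move=> vE; rewrite mxE enum_rankK vE. Qed.

(** Up to sign, the free values are the entries of the matrices [Q i] at the positions where [tri]
    leaves them arbitrary. *)
Lemma free_values_bij :
  set_bij (local_coordinates alpha) [set: 'rV[K]_(nvars n l alpha)]%classic
    (free_values alpha).
Proof.
split=> [z _ //|z z' /set_mem/local_coordinatesE[Q Qt ->]|w _].
  move=> /set_mem/local_coordinatesE[Q' Qt' ->] eqv.
  suff QQ' i : Q i = Q' i by congr pair; [|apply/ffunP => i]; rewrite ?ffunE QQ'.
  apply/matrixP => p q; case: (boolP (c i q < a i p)%N) => [lt_q|nlt]; last by rewrite Qt ?Qt'.
  case: (unliftP ord_max i) => [k|] iE; last first.
    have vP : free_entry alpha (inl (p, c i q)).
      by rewrite /= -iE; apply/(Mlower_freeP (alpha_piv _)); exists q.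
    pose v : var n l alpha := exist (fun v => is_true (free_entry alpha v)) _ vP.
    have := congr1 (fun u : 'rV_ _ => u 0 (enum_rank v)) eqv.
    by rewrite !(@free_values_inl _ v (p, c i q)) //= -iE !echelon_free.
  rewrite -but_last_lift in iE.
  have vP : free_entry alpha (inr (k, (a i p, q))).
    by rewrite /= -iE; apply/(Ncoord_freeP (alpha_piv _)); exists p.
  pose v : var n l alpha := exist (fun v => is_true (free_entry alpha v)) _ vP.
  have := congr1 (fun u : 'rV_ _ => u 0 (enum_rank v)) eqv.
  rewrite !(@free_values_inr _ v (k, (a i p, q))) //= !ffunE -iE !coechelon_free //.
  exact: oppr_inj.
pose wval x : K := if insub x is Some v then w 0 (enum_rank (v : var n l alpha)) else 0.
have wval0 x : ~~ free_entry alpha x -> wval x = 0 by move=> nx; rewrite /wval insubN.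
(* The minus sign compensates the one in [coechelon_free]. *)
pose Q k : 'M[K]_(l, n - l) := \matrix_(p, q)
  if unlift ord_max k is Some i then - wval (inr (i, (a k p, q)))
  else wval (inl (p, c k q)).
have Qt k : tri (a k) (c k) (Q k).
  move=> p q nlt; rewrite mxE; case: unliftP => [i|] kE; rewrite wval0 ?oppr0 //=.
    rewrite but_last_lift -kE; apply: contra nlt => /(Ncoord_freeP (alpha_piv _))[p' pE].
    by have [a_inj _ _ _] := ac k; rewrite (a_inj _ _ pE).
  rewrite -kE; apply: contra nlt => /(Mlower_freeP (alpha_piv _))[q' qE].
  by have [_ c_inj _ _] := ac k; rewrite (c_inj _ _ qE).
exists (coord_point Q); first by apply/local_coordinatesE; exists Q.
apply/rowP => k; rewrite -(enum_valK k); case vE: (val (enum_val k)) => [[p x]|[i [x q]]].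
  rewrite (free_values_inl _ vE) /=.
  have := valP (enum_val k); rewrite /= vE => /(Mlower_freeP (alpha_piv _))[q xE _].
  by rewrite xE echelon_free // mxE unlift_none -xE /wval -vE valK.
rewrite (free_values_inr _ vE) /= ffunE.
have := valP (enum_val k); rewrite /= vE => /(Ncoord_freeP (alpha_piv _))[p xE _].
rewrite xE coechelon_free // mxE but_last_lift liftK -but_last_lift opprK -xE.
by rewrite /wval -vE valK.
Qed.

Definition entry_poly x (y : K) : {mpoly K[nvars n l alpha]} :=
  if insub x is Some v then 'X_(enum_rank (v : var n l alpha)) else y%:MP.

(** The matrix with [Q = 0] supplies the prescribed entries 0 and 1 at the positions that are not
    free. *)
Definition M_poly (p : 'I_l) (x : 'I_n) :=
  entry_poly (inl (p, x)) (echelon (a ord_max) (c ord_max) 0 p x).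

Definition N_poly (i : 'I_r) (x : 'I_n) (q : 'I_(n - l)) :=
  entry_poly (inr (i, (x, q))) (coechelon (a (but_last i)) (c (but_last i)) 0 x q).

Lemma M_polyE (z : mx_point) p x : local_coordinates alpha z ->
  (M_poly p x).@[fun k => free_values alpha z 0 k] = z.1 p x.
Proof.
move=> zP; rewrite /M_poly /entry_poly; case: insubP => [v _ vE|nfree].
  by rewrite mevalXU (free_values_inl _ vE).
have [Q Qt ->] := (local_coordinatesE z).1 zP; rewrite mevalC /=.
have [_ _ _ cov] := ac ord_max; have [[k xE]|[j xE]] := cov x; rewrite xE.
  by rewrite !echelon_pivot.
rewrite !echelon_free // mxE Qt //; apply: contra nfree => lt_j.
by apply/(Mlower_freeP (alpha_piv _)); exists j.
Qed.

Lemma N_polyE (z : mx_point) i x q : local_coordinates alpha z ->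
  (N_poly i x q).@[fun k => free_values alpha z 0 k] = z.2 i x q.
Proof.
move=> zP; rewrite /N_poly /entry_poly; case: insubP => [v _ vE|nfree].
  by rewrite mevalXU (free_values_inr _ vE).
have [Q Qt ->] := (local_coordinatesE z).1 zP; rewrite mevalC /= ffunE.
have [_ _ _ cov] := ac (but_last i); have [[k xE]|[j xE]] := cov x; rewrite xE; last first.
  by rewrite !coechelon_pivot.
rewrite !coechelon_free // mxE Qt //; apply: contra nfree => lt_k.
by apply/(Ncoord_freeP (alpha_piv _)); exists k.
Qed.

Lemma M_poly_bidegree i p x :
  bidegree_le (M_var alpha) (N_var alpha i) 1 0 (M_poly p x).
Proof.
rewrite /M_poly /entry_poly; case: insubP => [v _ vE|_]; last exact: bidegree_leC.
by apply: bidegree_leX; rewrite /M_var /N_var enum_rankK vE.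
Qed.

Lemma N_poly_bidegree i x q :
  bidegree_le (M_var alpha) (N_var alpha i) 0 1 (N_poly i x q).
Proof.
rewrite /N_poly /entry_poly; case: insubP => [v _ vE|_]; last exact: bidegree_leC.
by apply: bidegree_leX; rewrite /M_var /N_var enum_rankK vE /= ?eqxx.
Qed.

Definition eqn_poly (Phi : 'I_r.+1 -> 'M[K]_n) (e : eqn n l r) :
    {mpoly K[nvars n l alpha]} :=
  \sum_y (\sum_x M_poly e.2.1 x * ((Phi ord_max *m invmx (Phi (but_last e.1))) x y)%:MP)
     * N_poly e.1 y e.2.2.

Lemma eqn_poly_bilinear Phi e :
  bilinear_poly (M_var alpha) (N_var alpha e.1) (eqn_poly Phi e).
Proof.
apply: (@bidegree_le_sum _ _ _ _ 1 1) => y.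
apply: (@bidegree_leM _ _ _ _ 1 0 0 1); last exact: N_poly_bidegree.
apply: bidegree_le_sum => x; apply: (@bidegree_leM _ _ _ _ 1 0 0 0).
  exact: M_poly_bidegree.
exact: bidegree_leC.
Qed.

Lemma eqn_polyE Phi (z : mx_point) e : local_coordinates alpha z ->
  system_lhs Phi z e.1 e.2.1 e.2.2
  = (eqn_poly Phi e).@[fun k => free_values alpha z 0 k].
Proof.
move=> zP; rewrite /system_lhs -[z.1 *m _ *m _]mulmxA mxE raddf_sum /=.
apply: eq_bigr => y _; rewrite mevalM N_polyE // mxE raddf_sum /=.
congr (_ * _); apply: eq_bigr => x _; by rewrite mevalM mevalC M_polyE.
Qed.

(** * Common zeroes and points of the intersection *)

Section Instance.
Variables (F : 'I_r.+1 -> flag K n) (Phi : 'I_r.+1 -> 'M[K]_n).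
Hypotheses (Phi_unit : forall i, Phi i \in unitmx) (FE : forall i, F i = flag_of_mx (Phi i)).
Hypothesis F_generic : generic_flags l F.
Hypothesis sum_codim : (\sum_i codim n l (alpha i) = l * (n - l))%N.

Let a_incr i : {homo a i : j k / (j < k)%N}. Proof. by case: (alpha_piv i). Qed.

Lemma sum_dim : (\sum_i (l * (n - l) - codim n l (alpha i)) = r * (l * (n - l)))%N.
Proof.
apply/eqP; rewrite -(eqn_add2r (l * (n - l))) -{2}sum_codim -big_split /=.
rewrite (eq_bigr (fun=> l * (n - l)))%N => [|i _]; last by rewrite subnK // leq_subr.
by rewrite sum_nat_const card_ord mulSn addnC.
Qed.

(** [H] lies in cells with pivots [b k <= a k], hence in the Schubert varieties of [b]. Genericity
    bounds their total dimension below by [r * (l * (n - l))], which is already the total for [a];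
    so [b = a] and [H] is in the open cells. *)
Lemma generic_echelon H (i : 'I_r.+1) :
  (forall i, in_schubert (a i) (F i) H) ->
  exists2 Q, tri (a i) (c i) Q & H = rowspan l (echelon (a i) (c i) Q *m Phi i).
Proof.
move=> aH.
have /fin_all_exists[b bP] k : exists b : {ffun 'I_l -> 'I_n},
    exists (d : {ffun 'I_(n - l) -> 'I_n}) (Q : 'M[K]_(l, n - l)),
    [/\ complementary b d, {homo b : j k / (j < k)%N}, tri b d Q,
        H = rowspan l (echelon b d Q *m Phi k) & forall j, (b j <= a k j)%N].
  by apply: in_schubert_echelon => //; rewrite -FE.
have bH k : in_schubert (b k) (F k) H.
  have [d [Q [bd b_incr Qt -> _]]] := bP k; rewrite FE.
  exact: echelon_in_schubert.
have sum0 : (\sum_k \sum_j (a k j - b k j) = 0)%N.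
  have sumD : (\sum_k \sum_j (a k j - j) = \sum_k \sum_j (b k j - j)
                + \sum_k \sum_j (a k j - b k j))%N.
    rewrite -big_split; apply: eq_bigr => k _; rewrite -big_split; apply: eq_bigr => j _ /=.
    have [d [Q [_ b_incr _ _ le_ba]]] := bP k.
    (* The subtractions are exact because [j <= b k j <= a k j]. *)
    by rewrite addnC addnBA ?incr_ge_id // subnK.
  have aE : (\sum_k \sum_j (a k j - j) = r * (l * (n - l)))%N.
    by rewrite -sum_dim; apply: eq_bigr => k _; rewrite (codimE (alpha_piv k)).
  by have := F_generic bH; move: sumD; rewrite aE; lia.
have ba k : b k =1 a k.
  move=> j; apply: val_inj; apply/eqP; rewrite eqn_leq.
  have [d [Q [_ _ _ _ ->]]] := bP k; rewrite -subn_eq0 /=.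
  move/eqP: sum0; rewrite sum_nat_eq0 => /forallP/(_ k)/implyP/(_ isT).
  by rewrite sum_nat_eq0 => /forallP/(_ j)/implyP/(_ isT).
have [d [Q [bd b_incr Qt HE _]]] := bP i.
have [Q' Qt' QQ'] : exists2 Q', tri (a i) (c i) Q' & echelon (b i) d Q = echelon (a i) (c i) Q'.
  apply: echelon_intro => // [j k|j x]; rewrite -ba; first by rewrite echelon_pivot.
  exact: echelon_right.
by exists Q'; rewrite -?QQ'.
Qed.

(** The factor [B] comes from [mul_coechelon]; it is invertible because the left side has rank
    [l]. *)
Lemma system_zero_echelon Q k : 
  system_lhs Phi (coord_point Q) k = 0 ->
  exists2 B, B \in unitmx &
    echelon (a ord_max) (c ord_max) (Q ord_max) *m Phi ord_max =
    B *m (echelon (a (but_last k)) (c (but_last k)) (Q (but_last k)) *m Phi (but_last k)).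
Proof.
rewrite /system_lhs ffunE /= => /(mul_coechelon (ac _)); set E := _ *m Phi ord_max.
set E' := echelon _ _ (Q (but_last k)); set B := _ *m (selmx K _)^T => EB.
have EE : E = B *m (E' *m Phi (but_last k)) by rewrite mulmxA -EB mulmxKV.
exists B => //; rewrite -row_free_unit -row_leq_rank.
have := echelon_free_row (Q ord_max) (ac ord_max) (Phi_unit ord_max).
by rewrite -row_leq_rank -/E EE => /leq_trans; apply; apply: mxrankM_maxl.
Qed.

Lemma system_zeros_bij :
  set_bij (system_zeros alpha Phi)
    [set H | forall i, schubert_variety l (alpha i) (F i) H]%classic
    (fun z : mx_point => rowspan l (z.1 *m Phi ord_max)).
Proof.
have schubertE i H : schubert_variety l (alpha i) (F i) H <-> in_schubert (a i) (F i) H.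
  by apply: in_schubertE => j; case: (alpha_piv i) => _ _ ->.
split.
- move=> z [/local_coordinatesE[Q Qt ->] zero] i /=; apply/schubertE; rewrite FE.
  case: (unliftP ord_max i) => [k|] ->; last exact: echelon_in_schubert.
  rewrite -but_last_lift; have [B B_unit ->] := system_zero_echelon (zero k).
  by rewrite rowspan_unitmxl //; apply: echelon_in_schubert.
(* Injectivity: equal row spaces have the same echelon form for the last flag, hence the same [M];
   comparing the relations of [system_zero_echelon] for each [k] then identifies the [N_k]. *)
- move=> z z' /set_mem[/local_coordinatesE[Q Qt ->] zero].
  move=> /set_mem[/local_coordinatesE[Q' Qt' ->] zero'] /= HE.
  have := subvv (rowspan l (echelon (a ord_max) (c ord_max) (Q ord_max) *m Phi ord_max)).
  rewrite {2}HE => /rowspan_mulP[B]; rewrite mulmxA => /(can_inj (mulmxK (Phi_unit _))).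
  move=> /(echelon_eq (ac _))[_ Qmax].
  suff QQ' k : Q (but_last k) = Q' (but_last k).
    by rewrite /coord_point Qmax; congr pair; apply/ffunP => k; rewrite !ffunE QQ'.
  have [B1 B1_unit E1] := system_zero_echelon (zero k).
  have [B2 _ E2] := system_zero_echelon (zero' k).
  move: E1; rewrite Qmax E2 !mulmxA => /(can_inj (mulmxK (Phi_unit _))).
  move=> /(congr1 (mulmx (invmx B1))); rewrite mulKmx // mulmxA => /esym.
  by case/(echelon_eq (ac _)).
(* Surjectivity: [generic_echelon] writes [H] in echelon form for every flag. The forms differ by a
   left factor [B], and each is annihilated by its own [coechelon]. *)
move=> H HX.
have aH i : in_schubert (a i) (F i) H by apply/schubertE/HX.
have /fin_all_exists2[Q Qt HE] i := generic_echelon i aH.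
exists (coord_point Q); last by rewrite /= -HE.
split=> [|k]; first by apply/local_coordinatesE; exists Q.
have [B EB] : exists B, echelon (a ord_max) (c ord_max) (Q ord_max) *m Phi ord_max =
    B *m (echelon (a (but_last k)) (c (but_last k)) (Q (but_last k)) *m Phi (but_last k)).
  by apply: rowspan_mulP; rewrite -!HE.
rewrite /system_lhs ffunE /= EB mulmxA mulmxK // -mulmxA.
suff -> : echelon (a (but_last k)) (c (but_last k)) (Q (but_last k)) *m
          coechelon (a (but_last k)) (c (but_last k)) (Q (but_last k)) = 0 by rewrite mulmx0.
by apply/(mul_coechelon (ac _)); rewrite echelon_a // mul1mx.
Qed.

End Instance.
End System.

Local Open Scope classical_set_scope.
Theorem theorem2p9 (R : realType) (n l r : nat) (alpha : 'I_r.+1 -> seq nat)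
    (l_ge1 : (1 <= l)%N) (l_le : (l <= n - 1)%N)
    (alphaP : schubert_problem n l alpha) :
  exists U : set ('I_r.+1 -> flag R[i] n),
    [/\ flags_zariski_open U, flags_zariski_dense U &
    forall (F : 'I_r.+1 -> flag R[i] n) (Phi : 'I_r.+1 -> 'M[R[i]]_n),
      U F -> (forall i, Phi i \in unitmx) ->
      (forall i, F i = flag_of_mx (Phi i)) ->
      [/\ (* the common zeroes are the points of the intersection *)
          set_bij (system_zeros alpha Phi)
            [set H | forall i, schubert_variety l (alpha i) (F i) H]
            (fun z : point n l r R[i] => rowspan l (z.1 *m Phi ord_max)),
          (* the free entries are coordinates on the space of (M, N_i) *)
          set_bij (local_coordinates alpha) [set: 'rV[R[i]]_(nvars n l alpha)]
            (free_values alpha),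
          (* in which the equations are given by bilinear polynomials *)
          exists E : eqn n l r -> {mpoly R[i][nvars n l alpha]},
            (forall e, bilinear_poly (M_var alpha) (N_var alpha e.1) (E e)) /\
            (forall z, local_coordinates alpha z -> forall e,
               system_lhs Phi z e.1 e.2.1 e.2.2
               = (E e).@[fun k => free_values alpha z 0 k]),
          #|eqn n l r| = (r * (l * (n - l)))%N &
          (* as many variables as equations *)
          nvars n l alpha
            = (\sum_(i < r.+1) (l * (n - l) - codim n l (alpha i)))%N /\
          nvars n l alpha = (r * (l * (n - l)))%N]].
Proof.
case: alphaP => alpha_incr sum_codim.
have le_ln : (l <= n)%N := leq_trans l_le (leq_subr 1 n).
have /fin_all_exists[a /fin_all_exists[c alpha_piv]] i := incr_seq_pivots le_ln (alpha_incr i).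
have [P P_neq0 P_generic] := generic_flags_poly R[i] n l r.
exists (flags_nonzero P); split; [exact: flags_nonzero_open|exact: flags_nonzero_dense|].
(* Membership in [U] gives matrices [Psi] that may differ from [Phi]; genericity depends only on
   [F], so it holds for the system of [Phi]. *)
move=> F Phi [Psi [Psi_unit PsiE PPsi]] Phi_unit FE.
have F_generic : generic_flags l F.
  suff -> : F = fun i => flag_of_mx (Psi i) by apply: P_generic.
  exact: funext.
split.
- exact: (system_zeros_bij alpha_piv).
- exact: (free_values_bij _ alpha_piv).
- exists (eqn_poly alpha a c Phi); split=> [e|z zP e]; first exact: eqn_poly_bilinear.
  exact: (eqn_polyE alpha_piv).
- by rewrite !card_prod !card_ord.
by rewrite (nvarsE alpha_piv) (sum_dim sum_codim).
Qed.
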